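(* Let $A$ be a finite dimensional weak $C^*$-Hopf algebra with dual $\hat A$, let $\hat\rho:M\to M\otimes\hat A$ be a coaction with dual left $A$-action $\triangleright$, $N:=M^A$, and let $\lambda\in\mathcal L(\hat A)$ be the left integral dual to the normalized Haar integral $h\in A$. Put $h_L:\hat A\to A$, $h_L(\varphi)=h\leftharpoonup\varphi$, and $\lambda_R:A\to\hat A$, $\lambda_R(a)=a\rightharpoonup\lambda$. Then: (i) The maps $\mathrm{id}_M\otimes h_L:M\otimes\hat A\to M\otimes A$ and $\mathrm{id}_M\otimes(\hat S^{-1}\circ\lambda_R):M\otimes A\to M\otimes\hat A$ are inverses of each other and pass to well defined left $M$-module isomorphisms $F_M:M\otimes_{A_L}\hat A\to M\rtimes A$ and $F_M^{-1}:M\rtimes A\to M\otimes_{A_L}\hat A$, respectively. (ii) $(F_M\circ\gamma)(m\otimes_Nm')=mhm'$ for all $m,m'\in M$. (iii) If the conditional expectation $E_h:M\to M^A$, $E_h(m)=h\triangleright m$, is of index-finite type then the map $\gamma$ is injective. (iv) $\gamma$ is bijective (i.e. $\hat\rho$ is Galois) if and only if $M\rtimes A=MhM$.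
   Context: A finite dimensional weak $C^*$-Hopf algebra is a finite dimensional $C^*$-algebra $A$ (unit $1$) with linear maps $\Delta:A\to A\otimes A$, $\varepsilon:A\to\mathbb C$, $S:A\to A$ such that, for all $x,y,z\in A$ in Sweedler notation: $\Delta(xy)=\Delta(x)\Delta(y)$; $\Delta(x^* )=\Delta(x)^*$; $(\Delta\otimes\mathrm{id})\Delta=(\mathrm{id}\otimes\Delta)\Delta$; $(\Delta(1)\otimes1)(1\otimes\Delta(1))=1_{(1)}\otimes1_{(2)}\otimes1_{(3)}$; $(\varepsilon\otimes\mathrm{id})\Delta=\mathrm{id}=(\mathrm{id}\otimes\varepsilon)\Delta$; $\varepsilon(xyz)=\varepsilon(xy_{(1)})\varepsilon(y_{(2)}z)$; $S(x_{(1)})x_{(2)}=1_{(1)}\varepsilon(x1_{(2)})$; $x_{(1)}S(x_{(2)})=\varepsilon(1_{(1)}x)1_{(2)}$; $S(x_{(1)})x_{(2)}S(x_{(3)})=S(x)$. ($\Delta(1)\neq 1\otimes 1$ in general; $S$ is automatically invertible.) Put $x_*:=S(x)^*$. The dual $\hat A$ is the dual vector space with $\langle\psi\varphi|x\rangle=\langle\psi\otimes\varphi|\Delta(x)\rangle$, $\langle\hat\Delta(\psi)|x\otimes y\rangle=\langle\psi|xy\rangle$, $\hat1=\varepsilon$, $\hat\varepsilon(\psi)=\langle\psi|1\rangle$, $\langle\hat S(\psi)|x\rangle=\langle\psi|S(x)\rangle$, $\langle\psi^*|x\rangle=\overline{\langle\psi|x_*\rangle}$; it is again a finite dimensional weak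 $C^*$-Hopf algebra. Write $\langle a\rightharpoonup\varphi|b\rangle=\langle\varphi|ba\rangle$, $\varphi\rightharpoonup a=a_{(1)}\langle\varphi|a_{(2)}\rangle$, $a\leftharpoonup\varphi=\langle\varphi|a_{(1)}\rangle a_{(2)}$. $A_L=\{(\varphi\otimes\mathrm{id})(\Delta(1)):\varphi\in\hat A\}$. Left integrals of $\hat A$: $\lambda\in\mathcal L(\hat A)$ iff $\psi\lambda=\psi_{(1)}\hat S(\psi_{(2)})\lambda$ for all $\psi$. The normalized Haar integral $h\in A$ is the unique element with $ah=a_{(1)}S(a_{(2)})h$, $ha=hS(a_{(1)})a_{(2)}$ for all $a$ and $S(h_{(1)})h_{(2)}=h_{(1)}S(h_{(2)})=1$. The dual left integral $\lambda$ is the unique element of $\hat A$ with $\lambda\rightharpoonup h=1$. An $A$-module algebra is a unital $*$-algebra $M$ with a linear left action $\triangleright$ of $A$ with $(ab)\triangleright m=a\triangleright(b\triangleright m)$, $1\triangleright m=m$, $a\triangleright(mn)=(a_{(1)}\triangleright m)(a_{(2)}\triangleright n)$, $(a\triangleright m)^*=a_*\triangleright m^*$, $a\triangleright1_M=(a_{(1)}S(a_{(2)}))\triangleright1_M$. Coactions $\hat\rho:M\to M\otimes\hat A$ correspond bijectively to such actions via $a\triangleright m=(\mathrm{id}\otimes a)(\hat\rho(m))$. $M^A=\{n: a\triangleright n=a_{(1)}S(a_{(2)})\triangleright n\ \forall a\}$. The crossed product $M\rtimes A=M\otimes_{A_L}A$ (elements $(m\rtimes a)$ modulo $(m\rtimes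 ba)=(m(b\triangleright1_M)\rtimes a)$, $b\in A_L$) has product $(m\rtimes a)(m'\rtimes a')=(m(a_{(1)}\triangleright m')\rtimes a_{(2)}a')$; write $m\equiv m\rtimes1$, $a\equiv1_M\rtimes a$; $MhM$ is the linear span of all $mhm'$. $M\otimes_{A_L}\hat A$ is the tensor product in which $a\in A_L$ acts on $M$ from the right by right multiplication with $a\triangleright1_M$ and on $\hat A$ from the left by right multiplication with $\hat S^{-1}(a\rightharpoonup\hat1)$. Let $\bar\rho:M\to M\otimes_{A_L}\hat A$ be $\hat\rho$ followed by the canonical projection. The map $\gamma:M\otimes_NM\to M\otimes_{A_L}\hat A$ is $\gamma(m\otimes_Nm')=(m\otimes\hat1)\bar\rho(m')$; $\hat\rho$ (equivalently $\triangleright$) is called Galois if $\gamma$ is bijective. $E_h$ is of index-finite type if there is a finite quasi-basis $u_i,v_i\in M$ with $\sum_iu_iE_h(v_im)=m=\sum_iE_h(mu_i)v_i$ for all $m\in M$. *)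

(* Defs.v *)
From HB Require Import structures.
From mathcomp Require Import all_boot all_order all_algebra all_field.
From mathcomp Require Import generic_quotient ring_quotient complex.
From mathcomp Require Import boolp classical_sets reals.
From mathcomp.multinomials Require Import freeg.

Set Implicit Arguments.
Unset Strict Implicit.
Unset Printing Implicit Defensive.

Import Order.TTheory GRing.Theory Num.Theory.
Local Open Scope quotient_scope.
Local Open Scope classical_set_scope.
Local Open Scope ring_scope.

Definition lspan (K : fieldType) (V : lmodType K) (P : set V) : set V :=
  [set x | exists2 s : seq (K * V),
     (forall p, p \in s -> P p.2) & x = \sum_(p <- s) p.1 *: p.2].

Section LinearQuotient.
Variables (K : fieldType) (V : lmodType K) (P : set V).

Definition lspanb (x : V) : bool := `[< lspan P x >].

Lemma lspan_lin c x y : lspan P x -> lspan P y -> lspan P (c *: x + y).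
Proof.
move=> [s sP ->] [t tP ->].
exists ([seq (c * p.1, p.2) | p <- s] ++ t).
  by move=> p; rewrite mem_cat => /orP[/mapP[q qs ->]|pt]; [exact: (sP q)|exact: tP].
rewrite big_cat big_map scaler_sumr /=; congr (_ + _).
by apply: eq_bigr => p _; rewrite scalerA.
Qed.

Lemma lspan0 : lspan P 0.
Proof. by exists [::] => //; rewrite big_nil. Qed.

Lemma sub_lspan x : P x -> lspan P x.
Proof.
move=> Px; exists [:: (1, x)]; last by rewrite big_seq1 scale1r.
by move=> p; rewrite inE => /eqP ->.
Qed.

Lemma lspanb_zmod : zmod_closed lspanb.
Proof.
split=> [|x y /asboolP Px /asboolP Py]; apply/asboolP; first exact: lspan0.
by rewrite -scaleN1r addrC; apply: lspan_lin.
Qed.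
HB.instance Definition _ := GRing.isZmodClosed.Build V lspanb lspanb_zmod.

Definition lspan_closed := GRing.ZmodClosed.clone V lspanb _.

Definition lquot : Type := Quotient.quot lspan_closed.
HB.instance Definition _ := GRing.Zmodule.on lquot.
HB.instance Definition _ := EqQuotient.on lquot.

Definition lpi (x : V) : lquot := \pi_lquot x.
Definition lrepr (q : lquot) : V := repr q.

Lemma lreprK q : lpi (lrepr q) = q.
Proof. exact: reprK. Qed.

Lemma lpi_eq x y : lpi x = lpi y <-> lspan P (x - y).
Proof.
split=> [/eqP|xy].
  by rewrite /lpi -(Quotient.idealrBE lspan_closed) => /asboolP.
by apply/eqP; rewrite /lpi -(Quotient.idealrBE lspan_closed);
  apply/asboolP.
Qed.

Lemma lpi_is_additive : zmod_morphism lpi.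
Proof. exact: (pi_is_zmod_morphism (Quotient.quot lspan_closed)). Qed.
HB.instance Definition _ := GRing.isZmodMorphism.Build V lquot lpi
  lpi_is_additive.

Definition lqscale (c : K) (q : lquot) : lquot := lpi (c *: lrepr q).

Lemma lqscaleE c x : lqscale c (lpi x) = lpi (c *: x).
Proof.
apply/lpi_eq; rewrite -scalerBr -[_ *: _]addr0.
by apply: lspan_lin; [apply/lpi_eq; rewrite lreprK|exact: lspan0].
Qed.

Lemma lqscaleA a b q : lqscale a (lqscale b q) = lqscale (a * b) q.
Proof. by rewrite -[q]lreprK !lqscaleE scalerA. Qed.
Lemma lqscale1 : left_id 1 lqscale.
Proof. by move=> q; rewrite -[q]lreprK lqscaleE scale1r. Qed.
Lemma lqscaleDr : right_distributive lqscale +%R.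
Proof.
move=> c p q; rewrite -[p]lreprK -[q]lreprK -raddfD !lqscaleE.
by rewrite scalerDr raddfD.
Qed.
Lemma lqscaleDl q : {morph lqscale^~ q : a b / a + b}.
Proof. by move=> a b; rewrite -[q]lreprK !lqscaleE scalerDl raddfD. Qed.
HB.instance Definition _ := GRing.Zmodule_isLmodule.Build K lquot
  lqscaleA lqscale1 lqscaleDr lqscaleDl.

Lemma lpi_is_scalable : scalable lpi.
Proof. by move=> c x; rewrite -lqscaleE. Qed.
HB.instance Definition _ := GRing.isScalable.Build K V lquot _ lpi
  lpi_is_scalable.

End LinearQuotient.

(* Tensor product of two (arbitrary) vector spaces: the free vector space   *)
(* on V * W modulo the bilinearity relations                                *)

Section Tensor.
Variables (K : fieldType) (V W : lmodType K).
Local Notation VW := {freeg (V * W)%type / K}.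

Definition fpair (v : V) (w : W) : VW := Freeg [:: (1, (v, w))].

Definition bilin_rel : set VW :=
  [set z | [\/ exists v v' w, z = fpair (v + v') w - fpair v w - fpair v' w,
               exists v w w', z = fpair v (w + w') - fpair v w - fpair v w',
               exists c v w, z = fpair (c *: v) w - c *: fpair v w
             | exists c v w, z = fpair v (c *: w) - c *: fpair v w]].

Definition tensor : Type := lquot bilin_rel.
HB.instance Definition _ := GRing.Lmodule.on tensor.

Definition tens (v : V) (w : W) : tensor := lpi bilin_rel (fpair v w).

(* A representation of t as a finite sum of pure tensors (see tseqP).       *)
Definition tseq (t : tensor) : seq (V * W) :=
  [seq (z.1 *: z.2.1, z.2.2) | z <- fgenum (lrepr t)].

(* The additive extension of f.  It is independent of the representation    *)
(* tseq t as soon as f is biadditive with f (c v) w = f v (c w), see        *)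
(* tlift_tens; this covers bilinear maps and conjugate-bilinear ones.       *)
Definition tlift (U : nmodType) (t : tensor) (f : V -> W -> U) : U :=
  \sum_(p <- tseq t) f p.1 p.2.

End Tensor.

Notation "v ⊗ w" := (tens v w) (at level 40, left associativity) : ring_scope.

(* Sweedler notation: \sw_(x1, x2 <- Delta x) F x1 x2 is F(x_(1), x_(2)).   *)
Notation "\sw_ ( a , b <- t ) F" := (tlift t (fun a b => F%R))
  (at level 41, a name, b name, t at level 50, F at level 41,
   format "\sw_ ( a ,  b  <-  t )  F") : ring_scope.

Section TensorTheory.
Variables (K : fieldType) (V W : lmodType K).
Local Notation T := (tensor V W).

Lemma tens_rel z : bilin_rel z -> lpi (@bilin_rel K V W) z = 0.
Proof.
by move=> zP; rewrite -(raddf0 (lpi _)); apply/lpi_eq; rewrite subr0;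
  exact: sub_lspan.
Qed.

Lemma tensDl (v v' : V) (w : W) : (v + v') ⊗ w = v ⊗ w + v' ⊗ w.
Proof.
apply/eqP; rewrite -subr_eq0 opprD addrA /tens -!raddfB; apply/eqP/tens_rel.
by apply: Or41; exists v, v', w.
Qed.
Lemma tensDr (v : V) (w w' : W) : v ⊗ (w + w') = v ⊗ w + v ⊗ w'.
Proof.
apply/eqP; rewrite -subr_eq0 opprD addrA /tens -!raddfB; apply/eqP/tens_rel.
by apply: Or42; exists v, w, w'.
Qed.
Lemma tensZl c (v : V) (w : W) : (c *: v) ⊗ w = c *: (v ⊗ w).
Proof.
apply/eqP; rewrite -subr_eq0 /tens -linearZ -raddfB; apply/eqP/tens_rel.
by apply: Or43; exists c, v, w.
Qed.
Lemma tensZr c (v : V) (w : W) : v ⊗ (c *: w) = c *: (v ⊗ w).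
Proof.
apply/eqP; rewrite -subr_eq0 /tens -linearZ -raddfB; apply/eqP/tens_rel.
by apply: Or44; exists c, v, w.
Qed.

Lemma Freeg_sum (I : choiceType) (s : seq (K * I)) :
  Freeg s = \sum_(z <- s) z.1 *: Freeg [:: (1, z.2)] :> {freeg I / K}.
Proof.
apply/eqP/freeg_eqP => x; rewrite raddf_sum /= coeff_Freeg.
elim: s => [|z s IHs]; first by rewrite big_nil precoeff_nil.
case: z => c i; rewrite precoeff_cons big_cons IHs /= coeffZ coeffU mul1r.
by rewrite mulrC.
Qed.

Lemma tseqP (t : T) : t = \sum_(p <- tseq t) p.1 ⊗ p.2.
Proof.
rewrite -[LHS]lreprK -[lrepr t]Freeg_enum Freeg_sum raddf_sum big_map.
by apply: eq_bigr => -[c [v w]] _ /=; rewrite tensZl linearZ.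
Qed.

Definition balanced (U : zmodType) (f : V -> W -> U) : Prop :=
  [/\ forall v v' w, f (v + v') w = f v w + f v' w,
      forall v w w', f v (w + w') = f v w + f v w'
    & forall c v w, f (c *: v) w = f v (c *: w)].

Section Lift.
Variable U : zmodType.
Implicit Types f : V -> W -> U.

Let g f (D : {freeg (V * W)%type / K}) : U :=
  \sum_(z <- fgenum D) f (z.1 *: z.2.1) z.2.2.

Let f0 f v w : balanced f -> f (0 *: v) w = 0.
Proof.
by case=> fDl _ _; apply: (addrI (f (0 *: v) w)); rewrite -fDl -scalerDl !addr0.
Qed.

Let gE f D (s : seq (V * W)) : balanced f -> uniq s -> {subset dom D <= s} ->
  g f D = \sum_(x <- s) f (coeff x D *: x.1) x.2.
Proof.
move=> fB us Ds.
transitivity (\sum_(x <- dom D) f (coeff x D *: x.1) x.2).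
  rewrite /g /dom big_map /fgenum !big_seq; apply: eq_bigr => -[c x] zD /=.
  congr (f (_ *: _) _); rewrite -[D in RHS]Freeg_enum coeff_Freeg.
  by rewrite (precoeff_mem_uniqE (kz := (c, x))) ?prefreeg_uniq.
rewrite [RHS](bigID (mem (dom D))) /= [X in _ + X]big1 ?addr0 => [|x xD].
  rewrite -[RHS]big_filter; apply: perm_big; apply: uniq_perm.
  - exact: uniq_dom.
  - exact: filter_uniq.
  - move=> x; rewrite mem_filter; case xD: (x \in dom D) => //=.
    by rewrite Ds.
by rewrite coeff_outdom // f0.
Qed.

Let gD f D E : balanced f -> g f (D + E) = g f D + g f E.
Proof.
move=> fB; pose s := undup (dom D ++ dom E ++ dom (D + E)).
have us : uniq s by exact: undup_uniq.
have sub H : {subset dom H <= dom D ++ dom E ++ dom (D + E)} ->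
    {subset dom H <= s} by move=> + x xH; rewrite mem_undup => /(_ x xH).
rewrite !(gE fB us); last 3 first.
- by apply: sub => x xH; rewrite !mem_cat xH ?orbT.
- by apply: sub => x xH; rewrite !mem_cat xH ?orbT.
- by apply: sub => x xH; rewrite !mem_cat xH ?orbT.
rewrite -big_split; apply: eq_bigr => x _ /=.
by rewrite coeffD scalerDl; case: fB => ->.
Qed.

Let balancedZ f c : balanced f -> balanced (fun v w => f (c *: v) w).
Proof.
by case=> fDl fDr fZ; split=> *; rewrite ?scalerDr -?fZ ?fDl ?fDr // scalerA
  mulrC -scalerA.
Qed.

Let gZ f c D : balanced f -> g f (c *: D) = g (fun v w => f (c *: v) w) D.
Proof.
move=> fB; pose s := undup (dom D ++ dom (c *: D)).
have us : uniq s by exact: undup_uniq.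
rewrite (gE fB us) ?(gE (balancedZ c fB) us); last 2 first.
- by move=> x xH; rewrite mem_undup mem_cat xH.
- by move=> x xH; rewrite mem_undup mem_cat xH orbT.
by apply: eq_bigr => x _; rewrite coeffZ scalerA.
Qed.

Let g0 f : balanced f -> g f 0 = 0.
Proof. by move=> fB; apply: (addrI (g f 0)); rewrite -gD // !addr0. Qed.

Let gB f D E : balanced f -> g f (D - E) = g f D - g f E.
Proof. by move=> fB; apply/(addIr (g f E)); rewrite -gD // !subrK. Qed.

Let g_pair f v w : balanced f -> g f (fpair v w) = f v w.
Proof.
move=> fB; rewrite (gE (s := [:: (v, w)]) fB) //.
  by rewrite big_seq1 /= coeffU eqxx mul1r scale1r.
by move=> x; rewrite domU ?oner_eq0.
Qed.

Let g_rel f z : balanced f -> bilin_rel z -> g f z = 0.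
Proof.
move=> fB; have [fDl fDr fZ] := fB; case.
- by move=> [v [v' [w ->]]]; rewrite !gB // !g_pair // fDl [f v w + _]addrC
    addrK subrr.
- by move=> [v [w [w' ->]]]; rewrite !gB // !g_pair // fDr [f v w + _]addrC
    addrK subrr.
- move=> [c [v [w ->]]]; rewrite gB // gZ // !g_pair ?subrr //.
  exact: balancedZ.
- move=> [c [v [w ->]]]; rewrite gB // gZ // !g_pair ?fZ ?subrr //.
  exact: balancedZ.
Qed.

Let g_span f z : balanced f -> lspan (@bilin_rel K V W) z -> g f z = 0.
Proof.
move=> fB [s sP ->]; elim: s sP => [|p s IHs] sP; first by rewrite big_nil g0.
rewrite big_cons gD // gZ // (g_rel (balancedZ _ fB)) ?add0r; last first.
  by apply: sP; rewrite mem_head.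
by apply: IHs => q qs; apply: sP; rewrite inE qs orbT.
Qed.

Lemma tlift_tens f v w : balanced f -> tlift (v ⊗ w) f = f v w.
Proof.
move=> fB; rewrite /tlift /tseq big_map -[LHS]/(g f _) -[RHS]g_pair //.
apply/eqP; rewrite -subr_eq0 -gB //; apply/eqP/g_span => //.
by apply/lpi_eq; rewrite lreprK.
Qed.

Lemma tliftD f (t u : T) : balanced f -> tlift (t + u) f = tlift t f + tlift u f.
Proof.
move=> fB; rewrite /tlift /tseq !big_map -[LHS]/(g f _).
rewrite -[RHS]/(g f _ + g f _) -gD //.
apply/eqP; rewrite -subr_eq0 -gB //; apply/eqP/g_span => //.
by apply/lpi_eq; rewrite raddfD /= !lreprK.
Qed.

Lemma tlift_sum f (I : Type) (r : seq I) (F : I -> T) : balanced f ->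
  tlift (\sum_(i <- r) F i) f = \sum_(i <- r) tlift (F i) f.
Proof.
move=> fB; elim: r => [|i r IHr]; last by rewrite !big_cons tliftD // IHr.
rewrite !big_nil; apply: (addrI (tlift (0 : T) f)).
by rewrite -tliftD // !addr0.
Qed.

End Lift.
End TensorTheory.

Section TensorMaps.
Variables (K : fieldType) (V W V' W' : lmodType K).

(* f and g may both be antilinear, as in Delta_star.                        *)
Definition tmap (f : V -> V') (g : W -> W') (t : tensor V W) : tensor V' W' :=
  \sw_(v, w <- t) f v ⊗ g w.

Definition tmul (mulV : V -> V -> V) (mulW : W -> W -> W)
    (t u : tensor V W) : tensor V W :=
  \sw_(v, w <- t) \sw_(v', w' <- u) mulV v v' ⊗ mulW w w'.

End TensorMaps.

Record starAlgebra (R : realType) (B : algType R[i]) (star : B -> B) : Prop := {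
  star_antilinear : forall (c : R[i]) x y,
    star (c *: x + y) = c^* *: star x + star y;
  star_antimul : forall x y, star (x * y) = star y * star x;
  star_invol : involutive star }.

(* Completeness is automatic in finite dimension.                           *)
Record CstarNorm (R : realType) (B : algType R[i]) (star : B -> B)
    (nrm : B -> R) : Prop := {
  cstar_eq0 : forall x, nrm x = 0 -> x = 0;
  cstar_triangle : forall x y, nrm (x + y) <= nrm x + nrm y;
  cstar_scale : forall (c : R[i]) x, (nrm (c *: x))%:C%C = `|c| * (nrm x)%:C%C;
  cstar_submul : forall x y, nrm (x * y) <= nrm x * nrm y;
  cstar_identity : forall x, nrm (star x * x) = nrm x ^+ 2 }.

Definition dual (R : realType) (A : falgType R[i]) := 'Hom(A, R[i]^o).

(* Triple tensors are taken in A ⊗ (A ⊗ A).                                 *)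
Record weakCstarHopf (R : realType) (A : falgType R[i]) := WeakCstarHopf {
  star : A -> A;
  Delta : {linear A -> tensor A A};
  counit : dual A;
  antipode : 'End(A);
  hopf_star : starAlgebra star;
  hopf_Cstar : exists nrm : A -> R, CstarNorm star nrm;
  DeltaM : forall x y, Delta (x * y) = tmul *%R *%R (Delta x) (Delta y);
  Delta_star : forall x, Delta (star x) = tmap star star (Delta x);
  Delta_coassoc : forall x,
    \sw_(a, x3 <- Delta x) \sw_(x1, x2 <- Delta a) x1 ⊗ (x2 ⊗ x3)
    = \sw_(x1, b <- Delta x) x1 ⊗ Delta b;
  Delta_unit :
    \sw_(a, b <- Delta 1) \sw_(c, d <- Delta 1) a ⊗ ((b * c) ⊗ d)
    = \sw_(a, b <- Delta 1) a ⊗ Delta b;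
  counitl : forall x, \sw_(x1, x2 <- Delta x) counit x1 *: x2 = x;
  counitr : forall x, \sw_(x1, x2 <- Delta x) counit x2 *: x1 = x;
  counit_weak : forall x y z,
    counit (x * y * z)
    = \sw_(y1, y2 <- Delta y) counit (x * y1) * counit (y2 * z);
  antipodel : forall x,
    \sw_(x1, x2 <- Delta x) antipode x1 * x2
    = \sw_(u1, u2 <- Delta 1) counit (x * u2) *: u1;
  antipoder : forall x,
    \sw_(x1, x2 <- Delta x) x1 * antipode x2
    = \sw_(u1, u2 <- Delta 1) counit (u1 * x) *: u2;
  antipode_mid : forall x,
    \sw_(a, x3 <- Delta x) \sw_(x1, x2 <- Delta a)
      antipode x1 * x2 * antipode x3
    = antipode x }.

Section WeakHopfTheory.
Variables (R : realType) (A : falgType R[i]) (H : weakCstarHopf A).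
Local Notation Delta := (Delta H).
Local Notation S := (antipode H).
Local Notation A_hat := (dual A).

Definition substar (x : A) : A := star H (S x).

(* The counital maps x_(1) S(x_(2)) and S(x_(1)) x_(2).                     *)
Definition epsL (x : A) : A := \sw_(x1, x2 <- Delta x) x1 * S x2.
Definition epsR (x : A) : A := \sw_(x1, x2 <- Delta x) S x1 * x2.

Definition A_L : set A :=
  [set a | exists phi : A_hat, a = \sw_(u1, u2 <- Delta 1) phi u1 *: u2].

(* These are a ⇀ phi, phi ⇀ a and a ↼ phi, in this order.                *)
Definition lact_dual (a : A) (phi : A_hat) : A_hat := (phi \o amulr a)%VF.
Definition dual_lact (phi : A_hat) (a : A) : A :=
  \sw_(a1, a2 <- Delta a) phi a2 *: a1.
Definition dual_ract (a : A) (phi : A_hat) : A :=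
  \sw_(a1, a2 <- Delta a) phi a1 *: a2.

Definition dual_mul (psi phi : A_hat) : A_hat :=
  linfun (fun x : A => \sw_(x1, x2 <- Delta x) (psi x1 * phi x2 : R[i]^o)).
Definition dual_one : A_hat := counit H.
Definition dual_antipode (psi : A_hat) : A_hat := (psi \o S)%VF.
(* S is invertible, and its transpose has the transposed inverse.           *)
Definition dual_antipode_inv (psi : A_hat) : A_hat := (psi \o S^-1)%VF.

(* The element t of A_hat ⊗ A_hat with <t|x ⊗ y> = <psi|x y>, written out   *)
(* in a basis of A and its dual basis.                                      *)
Definition dual_Delta (psi : A_hat) : tensor A_hat A_hat :=
  let e := vbasis {:A} in
  \sum_(i < \dim {:A}) \sum_(j < \dim {:A})
    psi (e`_i * e`_j) *:
      ((linfun (coord e i : A -> R[i]^o) : A_hat)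
       ⊗ (linfun (coord e j : A -> R[i]^o) : A_hat)).

Lemma dual_DeltaE psi x y :
  \sw_(psi1, psi2 <- dual_Delta psi) (psi1 x * psi2 y) = psi (x * y).
Proof.
have gB : balanced (fun psi1 psi2 : A_hat => psi1 x * psi2 y : R[i]^o).
  split=> [p p' q|p q q'|c p q]; rewrite ?add_lfunE ?mulrDl ?mulrDr //.
  by rewrite !scale_lfunE /= -scalerAl -scalerAr.
rewrite /dual_Delta tlift_sum //.
transitivity (\sum_(i < \dim {:A}) \sum_(j < \dim {:A})
    coord (vbasis {:A}) i x * coord (vbasis {:A}) j y
    * psi ((vbasis {:A})`_i * (vbasis {:A})`_j)).
  apply: eq_bigr => i _; rewrite tlift_sum //; apply: eq_bigr => j _.
  rewrite -tensZl tlift_tens // scale_lfunE !lfunE /= mulrC.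
  rewrite /GRing.scale /= mulrCA mulrC; congr (_ * _); exact: mulrC.
rewrite {2}(coord_vbasis (memvf x)) {2}(coord_vbasis (memvf y)).
rewrite mulr_suml linear_sum; apply: eq_bigr => i _.
rewrite mulr_sumr linear_sum; apply: eq_bigr => j _.
by rewrite -[in RHS]scalerAr -[in RHS]scalerAl !linearZ /= /GRing.scale /= mulrCA
  mulrA.
Qed.

Definition left_integral (lam : A_hat) : Prop :=
  forall psi : A_hat,
    dual_mul psi lam
    = dual_mul (\sw_(psi1, psi2 <- dual_Delta psi)
                  dual_mul psi1 (dual_antipode psi2)) lam.

Record haar_integral (h : A) : Prop := {
  haar_left : forall a, a * h = epsL a * h;
  haar_right : forall a, h * a = h * epsR a;
  haar_normr : epsR h = 1;
  haar_norml : epsL h = 1 }.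

Definition dual_left_integral (h : A) (lam : A_hat) : Prop :=
  left_integral lam /\ dual_lact lam h = 1.

Definition h_L (h : A) (phi : A_hat) : A := dual_ract h phi.
Definition lambda_R (lam : A_hat) (a : A) : A_hat := lact_dual a lam.

Section ModuleAlgebra.
Variables (M : algType R[i]) (starM : M -> M).

Record module_algebra (act : A -> M -> M) : Prop := {
  modalg_star : starAlgebra starM;
  act_linearl : forall (c : R[i]) a b m,
    act (c *: a + b) m = c *: act a m + act b m;
  act_linearr : forall (c : R[i]) a m n,
    act a (c *: m + n) = c *: act a m + act a n;
  actM : forall a b m, act (a * b) m = act a (act b m);
  act1 : forall m, act 1 m = m;
  act_mul : forall a m n,
    act a (m * n) = \sw_(a1, a2 <- Delta a) act a1 m * act a2 n;
  act_star : forall a m, starM (act a m) = act (substar a) (starM m);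
  act_unit : forall a, act a 1 = act (epsL a) 1 }.

Definition coact_act (rho : M -> tensor M A_hat) (a : A) (m : M) : M :=
  \sw_(m0, phi <- rho m) phi a *: m0.

(* Since A is finite dimensional, rho |-> coact_act rho is a bijection from *)
(* linear maps M -> M ⊗ A_hat to bilinear maps A * M -> M; coactions are    *)
(* the rho whose image is an A-module algebra structure.                    *)
Definition coaction (rho : {linear M -> tensor M A_hat}) : Prop :=
  module_algebra (coact_act rho).

Variable rho : {linear M -> tensor M A_hat}.
Local Notation act := (coact_act rho).

Definition fixed_points : set M :=
  [set n | forall a, act a n = act (epsL a) n].

Definition cond_exp (h : A) (m : M) : M := act h m.

Definition index_finite (E : M -> M) : Prop :=
  exists s : seq (M * M), forall m,
    \sum_(p <- s) p.1 * E (p.2 * m) = m /\ \sum_(p <- s) E (m * p.1) * p.2 = m.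

Definition tensN_rel : set (tensor M M) :=
  [set z | exists m n m', fixed_points n /\ z = (m * n) ⊗ m' - m ⊗ (n * m')].
Definition tensN : Type := lquot tensN_rel.
HB.instance Definition _ := GRing.Lmodule.on tensN.

Definition tensDual_rel : set (tensor M A_hat) :=
  [set z | exists m a phi, A_L a /\
     z = (m * act a 1) ⊗ phi
         - m ⊗ dual_mul phi (dual_antipode_inv (lact_dual a dual_one))].
Definition tensDual : Type := lquot tensDual_rel.
HB.instance Definition _ := GRing.Lmodule.on tensDual.

Definition cross_rel : set (tensor M A) :=
  [set z | exists m b a, A_L b /\ z = m ⊗ (b * a) - (m * act b 1) ⊗ a].
Definition cross : Type := lquot cross_rel.
HB.instance Definition _ := GRing.Lmodule.on cross.

Definition tensN_pi : tensor M M -> tensN := lpi tensN_rel.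
Definition tensDual_pi : tensor M A_hat -> tensDual := lpi tensDual_rel.
Definition cross_pi : tensor M A -> cross := lpi cross_rel.

(* Left M-module structures, m (m' ⊗ w) = m m' ⊗ w                          *)
Definition tensDual_lmul (m : M) (q : tensDual) : tensDual :=
  tensDual_pi (tmap ( *%R m) idfun (lrepr q)).
Definition cross_lmul (m : M) (q : cross) : cross :=
  cross_pi (tmap ( *%R m) idfun (lrepr q)).

(* (m ⋊ a) (m' ⋊ a') = m (a_(1) ▷ m') ⋊ a_(2) a'                            *)
Definition cross_mul (p q : cross) : cross :=
  cross_pi (\sw_(m, a <- lrepr p) \sw_(m', a' <- lrepr q)
              \sw_(a1, a2 <- Delta a) (m * act a1 m') ⊗ (a2 * a')).
Definition cross_of_M (m : M) : cross := cross_pi (m ⊗ 1).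
Definition cross_of_A (a : A) : cross := cross_pi (1 ⊗ a).

(* m h m' in the crossed product                                            *)
Definition MhM_elt (h : A) (m m' : M) : cross :=
  cross_mul (cross_mul (cross_of_M m) (cross_of_A h)) (cross_of_M m').
Definition MhM (h : A) : set cross :=
  lspan [set x | exists m m', x = MhM_elt h m m'].

(* gamma (m ⊗_N m') = (m ⊗ 1_hat) rho_bar(m'): multiplication by m ⊗ 1_hat  *)
(* from the left, in the algebra M ⊗ A_hat, passes to the quotient.         *)
Definition gamma (t : tensN) : tensDual :=
  \sw_(m, m' <- lrepr t)
    tensDual_pi (tmul *%R dual_mul (m ⊗ dual_one) (rho m')).

End ModuleAlgebra.
End WeakHopfTheory.

Arguments tensN {R A} H {M} rho.
Arguments tensDual {R A} H {M} rho.
Arguments cross {R A} H {M} rho.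
Arguments tensN_pi {R A} H {M} rho.
Arguments tensDual_pi {R A} H {M} rho.
Arguments cross_pi {R A} H {M} rho.
Arguments MhM_elt {R A} H {M} rho.
Arguments MhM {R A} H {M} rho.
Arguments gamma {R A} H {M} rho.

(* Main.v *)
Require Import Defs.
From HB Require Import structures.
From mathcomp Require Import all_boot all_order all_algebra all_field.
From mathcomp Require Import complex boolp classical_sets reals.

Set Implicit Arguments.
Unset Strict Implicit.
Unset Printing Implicit Defensive.

Import Order.TTheory GRing.Theory Num.Theory.
Local Open Scope classical_set_scope.
Local Open Scope ring_scope.

(** The key identities are h_(1) ⊗ c h_(2) = S(c) h_(1) ⊗ h_(2) and its mirror
    image h_(1) d ⊗ h_(2) = h_(1) ⊗ h_(2) S(d), which hold for the left and the
    right integral property of h, respectively.  Together with h^* = h they give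
    the antimultiplicativity of S, the involutivity of x |-> x_* (hence the
    bijectivity of S), and h_* = h.  Evaluating lambda on the second leg of the
    first one gives S(c) = h_(1) <lambda|c h_(2)>, i.e. S^-1-hat o lambda_R is
    inverse to h_L, and also eps(a S(y)) = eps(y a) for a in A_L, which is what
    makes id ⊗ h_L compatible with the two balanced tensor products.

    The crossed product acts on M by (m ⋊ a) x = m (a ▷ x), and m h m' acts as
    x |-> m E_h(m' x).  So if F(gamma(sum m_j ⊗ m'_j)) = 0 and
    m = sum_i E_h(m u_i) v_i for all m, then
    sum m_j ⊗ m'_j = sum_i (sum_j m_j E_h(m'_j u_i)) ⊗ v_i = 0.  If MhM is the
    whole crossed product, then 1 = sum u_i h v_i yields x = sum u_i E_h(v_i x),
    and the involution turns this into the identity needed for injectivity,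
    because h_* = h. *)

(** * Linear maps on tensor products and quotients *)

Section LinearMaps.
Variables (K : fieldType) (U V : lmodType K).

(** Sweedler bodies are anonymous functions. Packing one as a linear structure gives access to the
    library lemmas on morphisms, which the following lemmas restate for plain functions. *)
Lemma lin_pack (f : V -> U) : linear f -> exists g : {linear V -> U}, g = f :> (V -> U).
Proof.
move=> fL; pose g : {linear V -> U} :=
  HB.pack f (GRing.isLinear.Build K V U *:%R f fL).
by exists g.
Qed.

Lemma linB (f : V -> U) : linear f -> {morph f : x y / x - y}.
Proof. by case/lin_pack => g <- x y; rewrite raddfB. Qed.
Lemma linZ (f : V -> U) : linear f -> forall c, {morph f : x / c *: x}.
Proof. by case/lin_pack => g <- c x; rewrite linearZ. Qed.
Lemma linD (f : V -> U) : linear f -> {morph f : x y / x + y}.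
Proof. by case/lin_pack => g <- x y; rewrite raddfD. Qed.
Lemma lin0 (f : V -> U) : linear f -> f 0 = 0.
Proof. by case/lin_pack => g <-; rewrite raddf0. Qed.
Lemma lin_sum (f : V -> U) (I : Type) (r : seq I) (F : I -> V) : linear f ->
  f (\sum_(i <- r) F i) = \sum_(i <- r) f (F i).
Proof. by case/lin_pack => g <-; rewrite raddf_sum. Qed.
End LinearMaps.

Section Linearity.
Variables (K : fieldType) (U V W X : lmodType K).

Definition bilin (f : V -> W -> U) : Prop :=
  (forall w, linear (f^~ w)) /\ (forall v, linear (f v)).

Definition trilin (f : V -> W -> X -> U) : Prop :=
  [/\ forall w x, linear (fun v => f v w x),
      forall v x, linear (fun w => f v w x)
    & forall v w, linear (fun x => f v w x)].

Lemma bilin_balanced (f : V -> W -> U) : bilin f -> balanced f.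
Proof.
move=> [fl fr]; split=> [v v' w|v w w'|c v w].
- exact: (linD (fl w)).
- exact: (linD (fr v)).
- by rewrite (linZ (fl w)) (linZ (fr v)).
Qed.

Lemma trilin1 f : trilin f -> forall w x, linear (fun v => f v w x).
Proof. by case. Qed.
Lemma trilin2 f : trilin f -> forall v x, linear (fun w => f v w x).
Proof. by case. Qed.
Lemma trilin3 f : trilin f -> forall v w, linear (fun x => f v w x).
Proof. by case. Qed.

Lemma lin_id : linear (fun x : V => x).
Proof. by []. Qed.
Lemma lin_comp (f : V -> U) (g : W -> V) :
  linear f -> linear g -> linear (fun x => f (g x)).
Proof. by move=> fL gL c x y; rewrite gL fL. Qed.
Lemma lin_scaler (c : K) (g : V -> U) : linear g -> linear (fun x => c *: g x).
Proof. by move=> gL a x y; rewrite gL scalerDr !scalerA mulrC. Qed.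
Lemma lin_scalel (f : V -> K^o) (u : U) :
  linear f -> linear (fun x => (f x : K) *: u).
Proof. by move=> fL a x y; rewrite fL scalerDl -scalerA. Qed.
Lemma lin_bigsum (I : Type) (r : seq I) (F : I -> V -> U) :
  (forall i, linear (F i)) -> linear (fun x => \sum_(i <- r) F i x).
Proof.
move=> FL c x y; rewrite scaler_sumr -big_split; apply: eq_bigr => i _.
exact: FL.
Qed.
End Linearity.

Section LinearityAlg.
Variables (K : fieldType) (V : lmodType K) (B : algType K).
Lemma lin_mull (a : B) (g : V -> B) : linear g -> linear (fun x => a * g x).
Proof. by move=> gL c x y; rewrite gL mulrDr scalerAr. Qed.
Lemma lin_mulr (a : B) (g : V -> B) : linear g -> linear (fun x => g x * a).
Proof. by move=> gL c x y; rewrite gL mulrDl scalerAl. Qed.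
End LinearityAlg.

Section TensorLinearity.
Variables (K : fieldType) (V W : lmodType K).

Lemma eq_tlift (U : nmodType) (t : tensor V W) (f g : V -> W -> U) :
  (forall v w, f v w = g v w) -> tlift t f = tlift t g.
Proof. by move=> fg; apply: eq_bigr => p _. Qed.

Lemma exchange_tlift (V' W' : lmodType K) (U : nmodType) (t : tensor V W)
    (t' : tensor V' W') (f : V -> W -> V' -> W' -> U) :
  \sw_(v, w <- t) \sw_(v', w' <- t') f v w v' w'
  = \sw_(v', w' <- t') \sw_(v, w <- t) f v w v' w'.
Proof. exact: exchange_big. Qed.

Lemma lin_tlift (U U' : lmodType K) (g : U -> U') (t : tensor V W)
    (f : V -> W -> U) :
  linear g -> g (tlift t f) = \sw_(v, w <- t) g (f v w).
Proof. exact: lin_sum. Qed.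

Lemma mulr_tliftr (B : pzSemiRingType) (b : B) (t : tensor V W) (f : V -> W -> B) :
  b * tlift t f = \sw_(v, w <- t) (b * f v w).
Proof. exact: mulr_sumr. Qed.

Lemma mulr_tliftl (B : pzSemiRingType) (b : B) (t : tensor V W) (f : V -> W -> B) :
  tlift t f * b = \sw_(v, w <- t) (f v w * b).
Proof. exact: mulr_suml. Qed.

Lemma tliftZ (U : lmodType K) (f : V -> W -> U) c t : bilin f ->
  tlift (c *: t) f = c *: tlift t f.
Proof.
move=> fB; have fb := bilin_balanced fB.
rewrite [t in LHS]tseqP scaler_sumr tlift_sum // scaler_sumr.
apply: eq_bigr => p _; rewrite -tensZl tlift_tens //.
by case: fB => fl _; rewrite (linZ (fl _)).
Qed.

Lemma lin_tlift_tensor (X U : lmodType K) (t : X -> tensor V W) (f : V -> W -> U) :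
  linear t -> bilin f -> linear (fun x => tlift (t x) f).
Proof.
by move=> tL fB c x y; rewrite tL tliftD ?tliftZ //; exact: bilin_balanced.
Qed.

Lemma lin_tlift_body (X U : lmodType K) (t : tensor V W) (f : X -> V -> W -> U) :
  (forall v w, linear (fun x => f x v w)) -> linear (fun x => tlift t (f x)).
Proof. by move=> fL; apply: lin_bigsum => p. Qed.

Lemma bilin_tens : bilin (@tens K V W).
Proof.
by split=> [w|v] c x y; rewrite ?tensDl ?tensDr ?tensZl ?tensZr.
Qed.

Lemma bilin_tliftl (V' W' X U : lmodType K) (F : V -> X -> U) (t : tensor V' W')
    (g : V' -> W' -> V) x :
  bilin F -> F (tlift t g) x = \sw_(v, w <- t) F (g v w) x.
Proof. by case=> Fl _; exact: (lin_sum _ _ (Fl x)). Qed.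

Lemma bilin_tliftr (V' W' X U : lmodType K) (F : X -> V -> U) (t : tensor V' W')
    (g : V' -> W' -> V) x :
  bilin F -> F x (tlift t g) = \sw_(v, w <- t) F x (g v w).
Proof. by case=> _ Fr; exact: (lin_sum _ _ (Fr x)). Qed.

Lemma bilinZl (X U : lmodType K) (F : V -> X -> U) c v x :
  bilin F -> F (c *: v) x = c *: F v x.
Proof. by case=> Fl _; exact: (linZ (Fl x)). Qed.

Lemma bilinZr (X U : lmodType K) (F : X -> V -> U) c x v :
  bilin F -> F x (c *: v) = c *: F x v.
Proof. by case=> _ Fr; exact: (linZ (Fr x)). Qed.

Lemma tlift_tlift (V' W' : lmodType K) (U : zmodType) (t : tensor V' W')
    (g : V' -> W' -> tensor V W) (f : V -> W -> U) :
  balanced f ->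
  tlift (tlift t g) f = \sw_(v, w <- t) tlift (g v w) f.
Proof. by move=> fB; apply: tlift_sum. Qed.
End TensorLinearity.

Lemma coact_act_bilin (R : realType) (A : falgType R[i]) (M : algType R[i])
    (rho : {linear M -> tensor M (dual A)}) : bilin (coact_act rho).
Proof.
split=> [m|a]; rewrite /coact_act.
  apply: lin_tlift_body => v phi c x y.
  by rewrite linearP scalerDl -scalerA.
apply: lin_tlift_tensor; first exact: linearP.
split=> [phi|m] c x y; first by rewrite scalerDr !scalerA mulrC.
by rewrite add_lfunE scale_lfunE scalerDl -scalerA.
Qed.

(** Syntax-directed proof of multilinearity: each clause peels off the outermost operation. A
    Sweedler sum may contain the variable in its body or in its tensor, but not in both. *)
Ltac lin := intros; cbv beta;
  match goal with
  | |- bilin _ => split; lin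
  | |- trilin _ => split; lin
  | |- GRing.linear_for _ (fun x => x) => exact: lin_id
  | |- GRing.linear_for _ (fun x => tlift ?t (fun a b => @?f x a b)) =>
      refine (@lin_tlift_body _ _ _ _ _ t f _); lin
  | |- GRing.linear_for _ (fun x => tlift (@?t x) ?f) =>
      refine (@lin_tlift_tensor _ _ _ _ _ t f _ _); lin
  | |- GRing.linear_for _ (fun x => ?a * @?g x) =>
      refine (@lin_mull _ _ _ a g _); lin
  | |- GRing.linear_for _ (fun x => @?g x * ?a) =>
      refine (@lin_mulr _ _ _ a g _); lin
  | |- GRing.linear_for _ (fun x => ?c *: @?g x) =>
      refine (@lin_scaler _ _ _ c g _); lin
  | |- GRing.linear_for _ (fun x => @?f x *: ?u) =>
      refine (@lin_scalel _ _ _ f u _); lin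
  | |- GRing.linear_for _ (fun x => tens (@?g x) ?u) =>
      refine (@lin_comp _ _ _ _ _ g (proj1 (bilin_tens _ _) u) _); lin
  | |- GRing.linear_for _ (fun x => tens ?u (@?g x)) =>
      refine (@lin_comp _ _ _ _ _ g (proj2 (bilin_tens _ _) u) _); lin
  | |- GRing.linear_for _ (fun x => coact_act ?rho (@?g x) ?u) =>
      refine (@lin_comp _ _ _ _ _ g (proj1 (coact_act_bilin rho) u) _); lin
  | |- GRing.linear_for _ (fun x => coact_act ?rho ?u (@?g x)) =>
      refine (@lin_comp _ _ _ _ _ g (proj2 (coact_act_bilin rho) u) _); lin
  | H : bilin ?f |- GRing.linear_for _ (fun x => ?f (@?g x) ?a) =>
      refine (@lin_comp _ _ _ _ _ g (proj1 H a) _); lin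
  | H : bilin ?f |- GRing.linear_for _ (fun x => ?f ?a (@?g x)) =>
      refine (@lin_comp _ _ _ _ _ g (proj2 H a) _); lin
  | H : trilin ?f |- GRing.linear_for _ (fun x => ?f (@?g x) ?a ?b) =>
      refine (@lin_comp _ _ _ _ _ g (trilin1 H a b) _); lin
  | H : trilin ?f |- GRing.linear_for _ (fun x => ?f ?a (@?g x) ?b) =>
      refine (@lin_comp _ _ _ _ _ g (trilin2 H a b) _); lin
  | H : trilin ?f |- GRing.linear_for _ (fun x => ?f ?a ?b (@?g x)) =>
      refine (@lin_comp _ _ _ _ _ g (trilin3 H a b) _); lin
  | |- GRing.linear_for _ (fun x => ?f (@?g x)) =>
      refine (@lin_comp _ _ _ _ f g _ _); lin
  | H : bilin ?f |- GRing.linear_for _ (?f ?a) => exact: (proj2 H a)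
  | H : trilin ?f |- GRing.linear_for _ (?f ?a ?b) => exact: (trilin3 H a b)
  | |- GRing.linear_for _ (tens ?u) => exact: (proj2 (bilin_tens _ _) u)
  | |- GRing.linear_for _ (coact_act ?rho ?u) =>
      exact: (proj2 (coact_act_bilin rho) u)
  | H : GRing.linear_for _ ?f |- GRing.linear_for _ ?f => exact: H
  | |- GRing.linear_for _ _ => exact: linearP
  end.

(** * Maps descending to quotients, and tensor products of linear maps *)

Section QuotientMaps.
Variables (K : fieldType) (V U : lmodType K) (P : set V) (f : V -> U).
Hypotheses (fL : linear f) (fP : forall x, P x -> f x = 0).

(** The chosen representative differs from [x] by an element of the span of [P], on which [f]
    vanishes. This eliminates [lrepr] from maps defined through representatives. *)
Lemma lin_lrepr x : f (lrepr (lpi P x)) = f x.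
Proof.
apply/eqP; rewrite -subr_eq0 -(linB fL); apply/eqP.
have [s sP ->] : lspan P (lrepr (lpi P x) - x) by apply/lpi_eq; rewrite lreprK.
rewrite lin_sum // big_seq big1 // => p ps.
by rewrite (linZ fL) fP ?scaler0 //; exact: sP.
Qed.

Lemma linear_lquot : linear (fun q : lquot P => f (lrepr q)).
Proof.
move=> c p q; rewrite -[p in LHS]lreprK -[q in LHS]lreprK.
by rewrite -linearP lin_lrepr fL.
Qed.
End QuotientMaps.

Lemma lpi0P (K : fieldType) (V : lmodType K) (P : set V) x :
  lpi P x = 0 <-> lspan P x.
Proof. by rewrite -(raddf0 (lpi P)) lpi_eq subr0. Qed.

Lemma bilin_lrepr (K : fieldType) (V : lmodType K) (P : set V) (T : V -> V -> V) t u :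
  bilin T -> (forall z u, P z -> lspan P (T z u)) ->
  (forall t z, P z -> lspan P (T t z)) ->
  lpi P (T (lrepr (lpi P t)) (lrepr (lpi P u))) = lpi P (T t u).
Proof.
move=> TB Tl Tr.
have TL1 w : linear (fun t => lpi P (T t w)).
  by apply: (lin_comp (f := lpi P)); [exact: linearP|exact: (proj1 TB)].
have TL2 w : linear (fun u => lpi P (T w u)).
  by apply: (lin_comp (f := lpi P)); [exact: linearP|exact: (proj2 TB)].
rewrite (lin_lrepr (f := fun u => lpi P (T _ u))) //; last first.
  by move=> z /(Tr (lrepr (lpi P t))) /lpi0P.
by rewrite (lin_lrepr (f := fun t => lpi P (T t u))) // => z /(Tl _ u) /lpi0P.
Qed.

Section TensorMapTheory.
Variables (K : fieldType) (V W V' W' : lmodType K).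
Variables (f : V -> V') (g : W -> W').
Hypotheses (fL : linear f) (gL : linear g).

Lemma tmap_tens v w : tmap f g (v ⊗ w) = f v ⊗ g w.
Proof. by rewrite /tmap tlift_tens //; apply: bilin_balanced; lin. Qed.

Lemma linear_tmap : linear (tmap f g).
Proof. by apply: lin_tlift_tensor; [exact: lin_id|lin]. Qed.

Lemma tmap_sum (I : Type) (r : seq I) (F : I -> tensor V W) :
  tmap f g (\sum_(i <- r) F i) = \sum_(i <- r) tmap f g (F i).
Proof. exact: (lin_sum _ _ linear_tmap). Qed.
End TensorMapTheory.

Lemma tmapK (K : fieldType) (V W W' : lmodType K) (g : W -> W') (g' : W' -> W) :
  linear g -> linear g' -> cancel g g' ->
  cancel (tmap (@idfun V) g) (tmap (@idfun V) g').
Proof.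
move=> gL gL' gK t; have iL : linear (@idfun V) by [].
rewrite [t in LHS]tseqP !tmap_sum // [RHS]tseqP; apply: eq_bigr => p _.
by rewrite !tmap_tens // gK.
Qed.

(** * Sweedler calculus *)

Section SweedlerRules.
Variables (R : realType) (A : falgType R[i]) (H : weakCstarHopf A).
Local Notation Delta := (Delta H).
Local Notation star := (star H).

(** An axiom stated between tensors becomes a rewriting rule once an arbitrary bilinear [F] is
    evaluated on both sides; the other Sweedler rules arise in the same way. *)
Lemma sw_mul (U : lmodType R[i]) (F : A -> A -> U) x y : bilin F ->
  \sw_(a, b <- Delta (x * y)) F a b
  = \sw_(a, b <- Delta x) \sw_(c, d <- Delta y) F (a * c) (b * d).
Proof.
move=> FB; rewrite DeltaM /tmul tlift_tlift; last exact: bilin_balanced.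
apply: eq_tlift => a b; rewrite tlift_tlift; last exact: bilin_balanced.
by apply: eq_tlift => c d; rewrite tlift_tens //; exact: bilin_balanced.
Qed.

(** Triple tensors are bracketed to the right, so [F] enters as a bilinear map [G] whose second
    argument is itself a tensor. *)
Lemma sw_coassoc (U : lmodType R[i]) (F : A -> A -> A -> U) x : trilin F ->
  \sw_(p, c <- Delta x) \sw_(a, b <- Delta p) F a b c
  = \sw_(a, p <- Delta x) \sw_(b, c <- Delta p) F a b c.
Proof.
move=> FT; pose G a (t : tensor A A) := \sw_(b, c <- t) F a b c.
have GB : bilin G.
  by rewrite /G; lin.
have := congr1 (fun t => tlift t G) (Delta_coassoc H x).
rewrite !tlift_tlift; try exact: bilin_balanced.
have F23 a : bilin (F a) by lin.
move=> GE; rewrite -[RHS](_ : \sw_(a, p <- Delta x) G a (Delta p) = _) //.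
transitivity (\sw_(p, c <- Delta x) tlift (\sw_(a, b <- Delta p) a ⊗ (b ⊗ c)) G).
  apply: eq_tlift => p c; rewrite tlift_tlift; last exact: bilin_balanced.
  apply: eq_tlift => a b; rewrite tlift_tens; last exact: bilin_balanced.
  by rewrite /G tlift_tens //; exact: bilin_balanced.
by rewrite GE; apply: eq_tlift => a p; rewrite tlift_tens //; exact: bilin_balanced.
Qed.

Lemma starM x y : star (x * y) = star y * star x.
Proof. exact: (star_antimul (hopf_star H)). Qed.
Lemma starK : involutive star.
Proof. exact: (star_invol (hopf_star H)). Qed.
Lemma starD x y : star (x + y) = star x + star y.
Proof.
by have := star_antilinear (hopf_star H) 1 x y; rewrite rmorph1 !scale1r.
Qed.
Lemma star0 : star 0 = 0.
Proof. by apply: (addrI (star 0)); rewrite -starD !addr0. Qed.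
Lemma starZ c x : star (c *: x) = c^* *: star x.
Proof.
by have := star_antilinear (hopf_star H) c x 0; rewrite star0 !addr0.
Qed.
Lemma star1 : star 1 = 1.
Proof. by rewrite -[RHS]starK -[star 1 in RHS]mul1r starM starK mul1r. Qed.
Lemma star_tlift (V W : lmodType R[i]) (t : tensor V W) (F : V -> W -> A) :
  star (tlift t F) = \sw_(v, w <- t) star (F v w).
Proof.
rewrite /tlift; elim/big_rec2: _ => [|p x y _ <-]; first exact: star0.
exact: starD.
Qed.

Lemma balanced_star (U : zmodType) (F : A -> A -> U) :
  balanced F -> balanced (fun a b => F (star a) (star b)).
Proof.
by case=> FDl FDr FZ; split=> *; rewrite ?starD ?starZ ?FDl ?FDr ?FZ.
Qed.

Lemma sw_star (U : zmodType) (F : A -> A -> U) x : balanced F ->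
  \sw_(a, b <- Delta (star x)) F a b
  = \sw_(a, b <- Delta x) F (star a) (star b).
Proof.
move=> FB; rewrite Delta_star tlift_tlift //.
by apply: eq_tlift => a b; rewrite tlift_tens.
Qed.

Lemma sw_star1 (U : zmodType) (F : A -> A -> U) : balanced F ->
  \sw_(a, b <- Delta 1) F a b
  = \sw_(a, b <- Delta 1) F (star a) (star b).
Proof. by move=> FB; rewrite -{1}star1 sw_star. Qed.

(* The trilinear rules are also needed for conjugate-trilinear maps, whence *)
(* the weaker hypotheses here.                                              *)
Lemma balanced_tlift (U : zmodType) (F : A -> A -> A -> U) :
  (forall c, balanced (fun a b => F a b c)) -> (forall a, balanced (F a)) ->
  balanced (fun a (t : tensor A A) => tlift t (F a)).
Proof.
move=> F12 F23; split=> [a a' t|a t t'|c a t].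
- rewrite /tlift -big_split; apply: eq_bigr => p _ /=.
  by case: (F12 p.2) => ->.
- exact: tliftD.
- rewrite [t in RHS]tseqP scaler_sumr tlift_sum //; apply: eq_bigr => p _.
  rewrite -tensZl tlift_tens //.
  by case: (F12 p.2) => _ _ ->.
Qed.

Lemma sw_unitl_balanced (U : zmodType) (F : A -> A -> A -> U) :
  (forall c, balanced (fun a b => F a b c)) -> (forall a, balanced (F a)) ->
  \sw_(a, p <- Delta 1) \sw_(b, c <- Delta p) F a b c
  = \sw_(a, b <- Delta 1) \sw_(c, d <- Delta 1) F a (b * c) d.
Proof.
move=> F12 F23; pose G a (t : tensor A A) := tlift t (F a).
have GB : balanced G by exact: balanced_tlift.
have := congr1 (fun t => tlift t G) (Delta_unit H).
rewrite !tlift_tlift // => GE.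
transitivity (\sw_(a, p <- Delta 1) tlift (a ⊗ Delta p) G).
  by apply: eq_tlift => a p; rewrite tlift_tens.
rewrite -GE; apply: eq_tlift => a b.
rewrite tlift_tlift //; apply: eq_tlift => c d.
by rewrite tlift_tens // /G tlift_tens.
Qed.

Lemma trilin_balanced12 (U : lmodType R[i]) (F : A -> A -> A -> U) c :
  trilin F -> balanced (fun a b => F a b c).
Proof. by move=> FT; apply: bilin_balanced; lin. Qed.

Lemma trilin_balanced23 (U : lmodType R[i]) (F : A -> A -> A -> U) a :
  trilin F -> balanced (F a).
Proof. by move=> FT; apply: bilin_balanced; lin. Qed.

Lemma sw_unitl (U : lmodType R[i]) (F : A -> A -> A -> U) : trilin F ->
  \sw_(a, p <- Delta 1) \sw_(b, c <- Delta p) F a b c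
  = \sw_(a, b <- Delta 1) \sw_(c, d <- Delta 1) F a (b * c) d.
Proof.
by move=> FT; apply: sw_unitl_balanced => ?;
  [exact: trilin_balanced12|exact: trilin_balanced23].
Qed.

(* Obtained from Delta_unit by applying the involution in each leg.         *)
Lemma sw_unitr (U : lmodType R[i]) (F : A -> A -> A -> U) : trilin F ->
  \sw_(a, p <- Delta 1) \sw_(b, c <- Delta p) F a b c
  = \sw_(a, b <- Delta 1) \sw_(c, d <- Delta 1) F a (c * b) d.
Proof.
move=> FT; have F12 c : balanced (fun a b => F a b c).
  exact: trilin_balanced12.
have F23 a : balanced (F a) by exact: trilin_balanced23.
have G1 : bilin (fun a p => \sw_(b, c <- Delta p) F a b c) by lin.
have G2 : bilin (fun a b => \sw_(c, d <- Delta 1) F a (c * b) d) by lin.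
rewrite sw_star1; last exact: (bilin_balanced G1).
rewrite [RHS]sw_star1; last exact: (bilin_balanced G2).
transitivity (\sw_(a, p <- Delta 1) \sw_(b, c <- Delta p)
    F (star a) (star b) (star c)).
  by apply: eq_tlift => a p; rewrite sw_star.
rewrite (sw_unitl_balanced (F := fun a b c => F (star a) (star b) (star c))).
- apply: eq_tlift => a b; rewrite [RHS]sw_star1; last first.
    by apply: bilin_balanced; lin.
  by apply: eq_tlift => c d; rewrite starM.
- by move=> c; apply: (balanced_star (F12 (star c))).
- by move=> a; apply: balanced_star.
Qed.

End SweedlerRules.

(** * The counit and the coproduct on the counital subalgebras *)

Section CounitalSubalgebras.
Variables (R : realType) (A : falgType R[i]) (H : weakCstarHopf A).
Local Notation Delta := (Delta H).
Local Notation eps := (counit H).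
Local Notation star := (star H).
Local Notation epsL := (epsL H).
Local Notation epsR := (epsR H).

Lemma sw_counitl (U : lmodType R[i]) (G : A -> U) x : linear G ->
  \sw_(a, b <- Delta x) eps a *: G b = G x.
Proof.
move=> GL; rewrite -[in RHS](counitl H x) lin_tlift //.
by apply: eq_tlift => a b; rewrite linZ.
Qed.

Lemma sw_counitr (U : lmodType R[i]) (G : A -> U) x : linear G ->
  \sw_(a, b <- Delta x) eps b *: G a = G x.
Proof.
move=> GL; rewrite -[in RHS](counitr H x) lin_tlift //.
by apply: eq_tlift => a b; rewrite linZ.
Qed.

Lemma conj_tlift (V W : lmodType R[i]) (t : tensor V W) (F : V -> W -> R[i]) :
  (tlift t F)^* = \sw_(v, w <- t) (F v w)^*.
Proof. exact: rmorph_sum. Qed.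

(** The functional sending a to the conjugate of eps(star a) is again a left counit, and a left
    counit agrees with the right counit [eps]. *)
Lemma counit_star x : eps (star x) = (eps x : R[i])^*.
Proof.
have E1 : \sw_(a, b <- Delta x) (eps (star a) : R[i])^* *: b = x.
  rewrite -[RHS](starK H) -[in RHS](counitl H (star x)) sw_star; last first.
    by apply: bilin_balanced; lin.
  rewrite star_tlift; apply: eq_tlift => a b.
  by rewrite starZ starK.
rewrite -[LHS]conjCK; congr (_^*).
rewrite -[in RHS]E1 lin_tlift; last exact: linearP.
rewrite -[in LHS](counitr H x) star_tlift lin_tlift; last exact: linearP.
rewrite conj_tlift; apply: eq_tlift => a b.
by rewrite starZ !linearZ /= rmorphM /= conjCK mulrC.
Qed.

(** Mirror image of weak multiplicativity, obtained by conjugating the axiom with the involution. *)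
Lemma counit_weakr x y z :
  eps (x * y * z) = \sw_(y1, y2 <- Delta y) eps (x * y2) * eps (y1 * z).
Proof.
rewrite -[LHS]conjCK -(counit_star) !starM mulrA counit_weak sw_star; last first.
  by apply: bilin_balanced; lin.
rewrite conj_tlift; apply: eq_tlift => a b.
by rewrite rmorphM /= -!(starM H) !counit_star !conjCK mulrC.
Qed.

Lemma epsLE x : epsL x = \sw_(u, v <- Delta 1) eps (u * x) *: v.
Proof. exact: antipoder. Qed.
Lemma epsRE x : epsR x = \sw_(u, v <- Delta 1) eps (x * v) *: u.
Proof. exact: antipodel. Qed.

(** After expanding [epsR] through Delta 1, this is mirrored weak multiplicativity with middle
    factor 1; [counit_epsL] is the same argument for the other map. *)
Lemma counit_epsR x y : eps (epsR x * y) = eps (x * y).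
Proof.
rewrite epsRE mulr_tliftl lin_tlift; last exact: linearP.
rewrite -[in RHS](mulr1 x) counit_weakr; apply: eq_tlift => u v.
by rewrite -scalerAl linZ //; exact: linearP.
Qed.

Lemma counit_epsL x y : eps (x * epsL y) = eps (x * y).
Proof.
rewrite epsLE mulr_tliftr lin_tlift; last exact: linearP.
rewrite -[in RHS](mulr1 x) counit_weakr; apply: eq_tlift => u v.
rewrite -scalerAr linZ; last exact: linearP.
exact: mulrC.
Qed.

(** Companion of [A_L] for the mirror arguments: [epsR] takes its values here, so the right integral
    property of h meets elements of this set. *)
Definition A_R : set A :=
  [set a | exists phi : dual A, a = \sw_(u1, u2 <- Delta 1) phi u2 *: u1].

Lemma lact_dualE a (phi : dual A) b : lact_dual a phi b = phi (b * a).
Proof. by rewrite /lact_dual comp_lfunE lfunE. Qed.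

Lemma A_L_epsL x : A_L H (epsL x).
Proof.
by exists (lact_dual x eps); rewrite epsLE; apply: eq_tlift => u v;
  rewrite lact_dualE.
Qed.

Lemma A_R_epsR x : A_R (epsR x).
Proof.
exists (eps \o amull x)%VF; rewrite epsRE; apply: eq_tlift => u v.
by rewrite comp_lfunE lfunE.
Qed.

Section Bilinear.
Variables (U : lmodType R[i]) (F : A -> A -> U).
Hypothesis FB : bilin F.

(** With l = phi(1_(1)) 1_(2), this is the unit axiom with phi applied to the first of three legs.
    The two orders of the middle product put l on the left here and on the right in [sw_A_Lr]. *)
Lemma sw_A_L l : A_L H l ->
  \sw_(a, b <- Delta l) F a b = \sw_(u, v <- Delta 1) F (l * u) v.
Proof.
move=> [phi ->]; rewrite [LHS](lin_tlift (g := fun x => tlift (Delta x) F)); last by lin.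
transitivity (\sw_(a, p <- Delta 1) \sw_(b, c <- Delta p) phi a *: F b c).
  by apply: eq_tlift => a p; rewrite linearZ tliftZ // lin_tlift //; lin.
rewrite sw_unitl; last by lin.
rewrite exchange_tlift; apply: eq_tlift => u v.
rewrite mulr_tliftl (bilin_tliftl _ _ _ FB); apply: eq_tlift => a b.
by rewrite -scalerAl (bilinZl _ _ _ FB).
Qed.

Lemma sw_A_Lr l : A_L H l ->
  \sw_(a, b <- Delta l) F a b = \sw_(u, v <- Delta 1) F (u * l) v.
Proof.
move=> [phi ->]; rewrite [LHS](lin_tlift (g := fun x => tlift (Delta x) F)); last by lin.
transitivity (\sw_(a, p <- Delta 1) \sw_(b, c <- Delta p) phi a *: F b c).
  by apply: eq_tlift => a p; rewrite linearZ tliftZ // lin_tlift //; lin.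
rewrite sw_unitr; last by lin.
rewrite exchange_tlift; apply: eq_tlift => u v.
rewrite mulr_tliftr (bilin_tliftl _ _ _ FB); apply: eq_tlift => a b.
by rewrite -scalerAr (bilinZl _ _ _ FB).
Qed.

Lemma sw_A_R r : A_R r ->
  \sw_(a, b <- Delta r) F a b = \sw_(u, v <- Delta 1) F u (v * r).
Proof.
move=> [phi ->]; rewrite [LHS](lin_tlift (g := fun x => tlift (Delta x) F)); last by lin.
transitivity (\sw_(p, c <- Delta 1) \sw_(a, b <- Delta p) phi c *: F a b).
  by apply: eq_tlift => p c; rewrite linearZ tliftZ // lin_tlift //; lin.
rewrite (@sw_coassoc _ _ H _ (fun a b c => phi c *: F a b)) ?sw_unitl; try by lin.
apply: eq_tlift => u v.
rewrite mulr_tliftr (bilin_tliftr _ _ _ FB); apply: eq_tlift => a b.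
by rewrite -scalerAr (bilinZr _ _ _ FB).
Qed.

End Bilinear.

End CounitalSubalgebras.

(** * The counital maps inside a coproduct *)

Section CounitalMaps.
Variables (R : realType) (A : falgType R[i]) (H : weakCstarHopf A).
Local Notation Delta := (Delta H).
Local Notation S := (antipode H).
Local Notation eps := (counit H).
Local Notation epsL := (epsL H).
Local Notation epsR := (epsR H).

Section Bilinear.
Variables (U : lmodType R[i]) (F : A -> A -> U).
Hypothesis FB : bilin F.

Lemma sw_mulA_Ll l x : A_L H l ->
  \sw_(a, b <- Delta (l * x)) F a b = \sw_(a, b <- Delta x) F (l * a) b.
Proof.
move=> lL; rewrite sw_mul // -[x in RHS]mul1r sw_mul; last by lin.
rewrite (@sw_A_L _ _ H _ (fun a b => \sw_(c, d <- Delta x) F (a * c) (b * d))) //.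
  by do 2!apply: eq_tlift => ? ?; rewrite mulrA.
lin.
Qed.

Lemma sw_mulA_Lr l x : A_L H l ->
  \sw_(a, b <- Delta (x * l)) F a b = \sw_(a, b <- Delta x) F (a * l) b.
Proof.
move=> lL; rewrite sw_mul // -[x in RHS]mulr1 sw_mul; last by lin.
apply: eq_tlift => a b.
rewrite (@sw_A_Lr _ _ H _ (fun c d => F (a * c) (b * d))) //; last by lin.
by apply: eq_tlift => ? ?; rewrite mulrA.
Qed.

Lemma sw_mulA_Rr r x : A_R H r ->
  \sw_(a, b <- Delta (x * r)) F a b = \sw_(a, b <- Delta x) F a (b * r).
Proof.
move=> lL; rewrite sw_mul // -[x in RHS]mulr1 sw_mul; last by lin.
apply: eq_tlift => a b.
rewrite (@sw_A_R _ _ H _ (fun c d => F (a * c) (b * d))) //; last by lin.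
by apply: eq_tlift => ? ?; rewrite mulrA.
Qed.

(** Inserting the counit into x 1_(2) produces three legs of 1. The unit axiom splits them into two
    copies of Delta 1, one of which is absorbed by Delta x. *)
Lemma sw_epsR x :
  \sw_(a, b <- Delta x) F (epsR a) b = \sw_(u, v <- Delta 1) F u (x * v).
Proof.
transitivity (\sw_(u, v <- Delta 1) \sw_(a, b <- Delta x) eps (a * v) *: F u b).
  rewrite exchange_tlift; apply: eq_tlift => a b.
  rewrite epsRE (bilin_tliftl _ _ _ FB); apply: eq_tlift => u v.
  exact: bilinZl.
transitivity (\sw_(u, v <- Delta 1) \sw_(c, d <- Delta v)
    \sw_(a, b <- Delta x) eps (a * c) *: F u (b * d)); last first.
  apply: eq_tlift => u v; rewrite -[RHS](@sw_counitl _ _ H _ (F u)); last by lin.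
  by rewrite sw_mul 1?exchange_tlift //; lin.
rewrite (@sw_unitr _ _ H _ (fun u c d =>
    \sw_(a, b <- Delta x) eps (a * c) *: F u (b * d))); last by lin.
apply: eq_tlift => u v.
rewrite exchange_tlift -[x in LHS]mulr1 sw_mul; last by lin.
by do 2!apply: eq_tlift => ? ?; rewrite mulrA.
Qed.

Lemma sw_epsL x :
  \sw_(a, b <- Delta x) F a (epsL b) = \sw_(u, v <- Delta 1) F (u * x) v.
Proof.
transitivity (\sw_(u, v <- Delta 1) \sw_(a, b <- Delta x) eps (u * b) *: F a v).
  rewrite exchange_tlift; apply: eq_tlift => a b.
  rewrite epsLE (bilin_tliftr _ _ _ FB); apply: eq_tlift => u v.
  exact: bilinZr.
transitivity (\sw_(u, v <- Delta 1) \sw_(c, d <- Delta u)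
    \sw_(a, b <- Delta x) eps (d * b) *: F (c * a) v); last first.
  apply: eq_tlift => u v; rewrite -[RHS](@sw_counitr _ _ H _ (F^~ v)); last by lin.
  by rewrite sw_mul //; lin.
rewrite (@sw_coassoc _ _ H _ (fun c d v =>
    \sw_(a, b <- Delta x) eps (d * b) *: F (c * a) v)); last by lin.
rewrite (@sw_unitr _ _ H _ (fun c d v =>
    \sw_(a, b <- Delta x) eps (d * b) *: F (c * a) v)); last by lin.
rewrite [RHS]exchange_tlift; apply: eq_tlift => u v.
rewrite -[x in LHS]mul1r sw_mul; last by lin.
by do 2!apply: eq_tlift => ? ?; rewrite mulrA.
Qed.

(** Here the counital map is x -> 1_(1) eps(1_(2) x), which is neither [epsL] nor [epsR]. The proof
    is the absorption argument of [sw_epsR], with the second copy of Delta 1 multiplying Delta x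
    from the left. *)
Lemma sw_counit_unit x :
  \sw_(u, v <- Delta 1) \sw_(a, b <- Delta x) eps (v * a) *: F u b
  = \sw_(u, v <- Delta 1) F u (v * x).
Proof.
transitivity (\sw_(u, v <- Delta 1) \sw_(c, d <- Delta v)
    \sw_(a, b <- Delta x) eps (c * a) *: F u (d * b)); last first.
  apply: eq_tlift => u v; rewrite -[RHS](@sw_counitl _ _ H _ (F u)); last by lin.
  by rewrite sw_mul //; lin.
rewrite (@sw_unitl _ _ H _ (fun u c d =>
    \sw_(a, b <- Delta x) eps (c * a) *: F u (d * b))); last by lin.
apply: eq_tlift => u v.
rewrite -[x in LHS]mul1r sw_mul; last by lin.
by do 2!apply: eq_tlift => ? ?; rewrite mulrA.
Qed.

End Bilinear.

Lemma sw_antipode_epsL x : \sw_(a, b <- Delta x) S a * epsL b = S x.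
Proof.
rewrite -[RHS]antipode_mid sw_coassoc; last by lin.
apply: eq_tlift => a p; rewrite /epsL mulr_tliftr.
by apply: eq_tlift => b c; rewrite mulrA.
Qed.

Lemma sw_epsR_antipode x : \sw_(a, b <- Delta x) epsR a * S b = S x.
Proof.
rewrite -[RHS]antipode_mid.
by apply: eq_tlift => p c; rewrite /epsR mulr_tliftl.
Qed.

Lemma counit_epsLE x : eps (epsL x) = eps x.
Proof. by rewrite -[epsL x]mul1r counit_epsL mul1r. Qed.

End CounitalMaps.

(** * The Haar integral *)

Section HaarIntegral.
Variables (R : realType) (A : falgType R[i]) (H : weakCstarHopf A).
Local Notation Delta := (Delta H).
Local Notation S := (antipode H).
Local Notation eps := (counit H).
Local Notation star := (star H).
Local Notation epsL := (epsL H).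
Local Notation epsR := (epsR H).

Section Haar.
Variable h : A.
Hypothesis hh : haar_integral H h.

(** Start from S(c) = S(c_(1)) epsL(c_(2)). Since epsL(c_(2)) h = c_(2) h, the right side becomes
    S(c_(1)) c_(2) h_(1) ⊗ c_(3) h_(2) = epsR(c_(1)) h_(1) ⊗ c_(2) h_(2), and [sw_epsR] turns it
    into 1_(1) h_(1) ⊗ c 1_(2) h_(2). *)
Lemma sw_haarl (U : lmodType R[i]) (F : A -> A -> U) c : bilin F ->
  \sw_(a, b <- Delta h) F a (c * b) = \sw_(a, b <- Delta h) F (S c * a) b.
Proof.
move=> FB; transitivity (\sw_(p, q <- Delta c) \sw_(a, b <- Delta h)
    F (S p * (epsL q * a)) b); last first.
  rewrite exchange_tlift; apply: eq_tlift => a b.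
  rewrite -[S c](sw_antipode_epsL H) mulr_tliftl (bilin_tliftl _ _ _ FB).
  by apply: eq_tlift => p q; rewrite mulrA.
transitivity (\sw_(p, q <- Delta c) \sw_(s, t <- Delta q) \sw_(a, b <- Delta h)
    F (S p * (s * a)) (t * b)); last first.
  apply: eq_tlift => p q.
  rewrite -(@sw_mulA_Ll _ _ H _ (fun a b => F (S p * a) b)); last exact: A_L_epsL.
    by rewrite -(haar_left hh) sw_mul //; lin.
  lin.
rewrite -(@sw_coassoc _ _ H _ (fun p s t => \sw_(a, b <- Delta h)
    F (S p * (s * a)) (t * b))); last by lin.
transitivity (\sw_(y, t <- Delta c) \sw_(a, b <- Delta h)
    F (epsR y * a) (t * b)).
  rewrite (@sw_epsR _ _ H _ (fun y t => \sw_(a, b <- Delta h)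
      F (y * a) (t * b))); last by lin.
  rewrite -[h in LHS]mul1r sw_mul; last by lin.
  by do 2!apply: eq_tlift => ? ?; rewrite mulrA.
apply: eq_tlift => y t; rewrite exchange_tlift; apply: eq_tlift => a b.
rewrite /epsR mulr_tliftl (bilin_tliftl _ _ _ FB).
by apply: eq_tlift => p s; rewrite mulrA.
Qed.

(** The mirrored computation starts from S(d) = epsR(d_(1)) S(d_(2)) and ends with [sw_epsL]. *)
Lemma sw_haarr (U : lmodType R[i]) (F : A -> A -> U) d : bilin F ->
  \sw_(a, b <- Delta h) F (a * d) b = \sw_(a, b <- Delta h) F a (b * S d).
Proof.
move=> FB; transitivity (\sw_(p, q <- Delta d) \sw_(a, b <- Delta h)
    F a (b * epsR p * S q)); last first.
  rewrite exchange_tlift; apply: eq_tlift => a b.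
  rewrite -[S d](sw_epsR_antipode H) mulr_tliftr (bilin_tliftr _ _ _ FB).
  by apply: eq_tlift => p q; rewrite mulrA.
transitivity (\sw_(p, q <- Delta d) \sw_(s, t <- Delta p) \sw_(a, b <- Delta h)
    F (a * s) (b * t * S q)); last first.
  apply: eq_tlift => p q.
  rewrite -(@sw_mulA_Rr _ _ H _ (fun a b => F a (b * S q))); last exact: A_R_epsR.
    by rewrite -(haar_right hh) sw_mul 1?exchange_tlift //; lin.
  lin.
rewrite (@sw_coassoc _ _ H _ (fun s t q => \sw_(a, b <- Delta h)
    F (a * s) (b * t * S q))); last by lin.
transitivity (\sw_(s, y <- Delta d) \sw_(a, b <- Delta h)
    F (a * s) (b * epsL y)).
  rewrite (@sw_epsL _ _ H _ (fun s y => \sw_(a, b <- Delta h)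
      F (a * s) (b * y))); last by lin.
  rewrite -[h in LHS]mulr1 sw_mul; last by lin.
  by rewrite exchange_tlift; do 2!apply: eq_tlift => ? ?; rewrite mulrA.
apply: eq_tlift => s y; rewrite exchange_tlift; apply: eq_tlift => a b.
rewrite /epsL mulr_tliftr (bilin_tliftr _ _ _ FB).
by apply: eq_tlift => t q; rewrite mulrA.
Qed.

(** This form of the right integral property is the one that the involution carries to the left
    integral property. It follows from h v = h epsR(v) by weak multiplicativity with middle factor
    1. *)
Lemma haar_swap b : \sw_(u, v <- Delta 1) eps (b * u) *: (h * v) = h * b.
Proof.
transitivity (\sw_(u, v <- Delta 1) \sw_(u', v' <- Delta 1)
    (eps (b * u) * eps (v * v')) *: (h * u')).
  apply: eq_tlift => u v; rewrite (haar_right hh) epsRE mulr_tliftr.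
  rewrite (lin_tlift (g := fun x => eps (b * u) *: x)); last by lin.
  by apply: eq_tlift => u' v'; rewrite -scalerAr scalerA.
rewrite exchange_tlift (haar_right hh b) epsRE mulr_tliftr.
apply: eq_tlift => u' v'; rewrite -scalerAr -[b in RHS]mulr1 counit_weak.
(* Scalars are taken in the regular module [R[i]^o], so that scaling a fixed vector is a linear
   map. *)
by rewrite [RHS](lin_tlift (g := fun c : R[i]^o => (c : R[i]) *: (h * u'))) //; lin.
Qed.

(** The element star h is a left integral too, so h (star h) = epsL(h) (star h) = star h. The
    product h (star h) is self-adjoint, hence so is star h. *)
Lemma haar_star : star h = h.
Proof.
have star_left a : a * star h = epsL a * star h.
  rewrite -[a in LHS](starK H) -starM -haar_swap star_tlift.
  rewrite epsLE mulr_tliftl [RHS]sw_star1; last by apply: bilin_balanced; lin.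
  apply: eq_tlift => u v.
  by rewrite starZ (starM H h) -counit_star starM starK -scalerAl.
have hsh : h * star h = star h by rewrite star_left (haar_norml hh) mul1r.
by rewrite -[RHS](starK H) -[in RHS]hsh starM starK hsh.
Qed.

End Haar.

End HaarIntegral.

(** * The antipode and the involution x_* by means of the Haar integral *)

Section AntipodeHaar.
Variables (R : realType) (A : falgType R[i]) (H : weakCstarHopf A).
Local Notation Delta := (Delta H).
Local Notation S := (antipode H).
Local Notation eps := (counit H).
Local Notation star := (star H).
Local Notation epsL := (epsL H).
Local Notation epsR := (epsR H).

Section HaarIntegral.
Variable h : A.
Hypothesis hh : haar_integral H h.

Lemma haar_sw_norml x : \sw_(a, b <- Delta h) x * (a * S b) = x.
Proof. by rewrite -mulr_tliftr -/(epsL h) (haar_norml hh) mulr1. Qed.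

Lemma haar_sw_normr x : \sw_(a, b <- Delta h) S a * b * x = x.
Proof. by rewrite -mulr_tliftl -/(epsR h) (haar_normr hh) mul1r. Qed.

(** Since h_(1) S(h_(2)) = 1, S(x y) equals h_(1) S(x y h_(2)). Moving y and then x back to the
    first leg separately yields S(y) S(x). *)
Lemma antipodeM x y : S (x * y) = S y * S x.
Proof.
rewrite -[LHS]haar_sw_norml.
transitivity (\sw_(a, b <- Delta h) S (x * y) * a * S b).
  by apply: eq_tlift => a b; rewrite mulrA.
rewrite -(@sw_haarl _ _ H _ hh _ (fun a b => a * S b)); last by lin.
transitivity (\sw_(a, b <- Delta h) a * S (x * (y * b))).
  by apply: eq_tlift => a b; rewrite mulrA.
rewrite (@sw_haarl _ _ H _ hh _ (fun a b => a * S (x * b))); last by lin.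
rewrite (@sw_haarl _ _ H _ hh _ (fun a b => S y * a * S b)); last by lin.
rewrite -[RHS]haar_sw_norml.
by apply: eq_tlift => a b; rewrite !mulrA.
Qed.

Lemma antipode_substar c : S (substar H c) = star c.
Proof.
have F0B : bilin (fun a b => S a * b) by lin.
have F0 := balanced_star H (bilin_balanced F0B).
(* The map to be applied is conjugate-bilinear, so [sw_haarl] is used with the universal bilinear
   map [tens] and the lift is taken afterwards. *)
have /(congr1 (fun t => tlift t (fun a b => S (star a) * star b))) :=
  @sw_haarl _ _ H _ hh _ (@tens _ _ _) c (bilin_tens _ _).
rewrite !tlift_tlift // => E.
rewrite -[RHS]haar_sw_normr -[LHS]haar_sw_normr.
have G1 : bilin (fun a b => S a * b * S (substar H c)) by lin.
have G2 : bilin (fun a b => S a * b * star c) by lin.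
have G3 : bilin (fun a b => S (a * substar H c) * b) by lin.
transitivity (\sw_(a, b <- Delta h) S (a * substar H c) * b).
  rewrite (@sw_haarr _ _ H _ hh _ (fun a b => S a * b)) //.
  by apply: eq_tlift => a b; rewrite mulrA.
rewrite -(haar_star hh) sw_star; last exact: (bilin_balanced G3).
rewrite [RHS]sw_star; last exact: (bilin_balanced G2).
transitivity (\sw_(a, b <- Delta h)
    tlift ((S c * a) ⊗ b) (fun a b => S (star a) * star b)).
  by apply: eq_tlift => a b; rewrite tlift_tens // starM.
rewrite -E; apply: eq_tlift => a b.
by rewrite tlift_tens // starM mulrA.
Qed.

Lemma substarK : involutive (substar H).
Proof. by move=> c; rewrite {1}/substar antipode_substar starK. Qed.

Lemma substarM x y : substar H (x * y) = substar H x * substar H y.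
Proof. by rewrite /substar antipodeM starM. Qed.

Lemma antipode_inj : injective S.
Proof.
by move=> x y xy; rewrite -[x]substarK -[y]substarK /substar xy.
Qed.

Lemma antipodeK : cancel S S^-1%VF.
Proof. by apply: lker0_lfunK; apply/lker0P; exact: antipode_inj. Qed.

Lemma antipodeVK : cancel S^-1%VF S.
Proof.
by move=> x; rewrite -[x](starK H) -antipode_substar antipodeK.
Qed.

(** With h = h_(1) eps(h_(2)), [sw_haarl] gives h_(1) eps(h h_(2)), and [eps] sees the left factor h
    only through epsR(h) = 1. *)
Lemma antipode_haar_mul : S h * h = h.
Proof.
transitivity (S h * \sw_(a, b <- Delta h) eps b *: a); first by rewrite counitr.
rewrite mulr_tliftr.
transitivity (\sw_(a, b <- Delta h) eps (h * b) *: a).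
  rewrite (@sw_haarl _ _ H _ hh _ (fun a b => eps b *: a)); last by lin.
  by apply: eq_tlift => a b; rewrite -scalerAr.
rewrite -[RHS](counitr H h); apply: eq_tlift => a b.
by rewrite -counit_epsR (haar_normr hh) mul1r.
Qed.

Lemma mul_antipode_haar : h * S h = h.
Proof.
transitivity ((\sw_(a, b <- Delta h) eps a *: b) * S h); first by rewrite counitl.
rewrite mulr_tliftl.
transitivity (\sw_(a, b <- Delta h) eps (a * h) *: b).
  rewrite (@sw_haarr _ _ H _ hh _ (fun a b => eps a *: b)); last by lin.
  by apply: eq_tlift => a b; rewrite -scalerAl.
rewrite -[RHS](counitl H h); apply: eq_tlift => a b.
by rewrite -(counit_epsL H a) (haar_norml hh) mulr1.
Qed.

(** Both h h_* = h and h_* h = h hold. Applying the multiplicative involution x_* to the first one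
    gives h_* h = h_*. *)
Lemma substar_haar : substar H h = h.
Proof.
have hq : h * substar H h = h.
  by rewrite -{1}(haar_star hh) -starM antipode_haar_mul (haar_star hh).
have qh : substar H h * h = h.
  by rewrite -{2}(haar_star hh) -starM mul_antipode_haar (haar_star hh).
by rewrite -[RHS]qh -[in LHS]hq substarM substarK.
Qed.

End HaarIntegral.

End AntipodeHaar.

(** * The dual left integral and the inverse of [h_L] *)

Section DualIntegral.
Variables (R : realType) (A : falgType R[i]) (H : weakCstarHopf A).
Local Notation Delta := (Delta H).
Local Notation S := (antipode H).
Local Notation eps := (counit H).
Local Notation epsL := (epsL H).

Lemma dual_mulE (psi phi : dual A) x :
  dual_mul H psi phi x = \sw_(a, b <- Delta x) (psi a * phi b).
Proof.
have /lin_pack[g gE] : linear (fun x : A =>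
    \sw_(a, b <- Delta x) (psi a * phi b : R[i]^o)) by lin.
by rewrite /dual_mul -gE lfunE gE.
Qed.

Lemma dual_one_mul (phi : dual A) : dual_mul H (dual_one H) phi = phi.
Proof.
apply/lfunP => x; rewrite dual_mulE.
by rewrite -[RHS](@sw_counitl _ _ H _ phi) //; exact: linearP.
Qed.

Lemma dual_antipode_invE (psi : dual A) x :
  dual_antipode_inv H psi x = psi (S^-1%VF x).
Proof. by rewrite comp_lfunE. Qed.

Lemma linear_h_L h : linear (h_L H h).
Proof.
apply: lin_tlift_body => a b c x y.
by rewrite add_lfunE scale_lfunE scalerDl -scalerA.
Qed.

Lemma linear_inv_lambda_R lam :
  linear (dual_antipode_inv H \o lambda_R lam).
Proof.
move=> c x y; apply/lfunP => z.
rewrite add_lfunE scale_lfunE !dual_antipode_invE !lact_dualE.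
by rewrite mulrDr -scalerAr linearP.
Qed.

Section HaarIntegral.
Variables (h : A) (lam : dual A).
Hypothesis (hh : haar_integral H h) (lamh : dual_lact H lam h = 1).

(** Replace x by l = epsL(x) and insert the counit into lam(l h). As l stays in the first leg of
    Delta(l h), the result is eps(l h_(1)) lam(h_(2)) = eps(l), by the normalization of [lam]. *)
Lemma lam_mul_haar x : lam (x * h) = eps x.
Proof.
rewrite (haar_left hh) -(@sw_counitl _ _ H _ lam); last exact: linearP.
rewrite (@sw_mulA_Ll _ _ H _ (fun a b => eps a *: lam b)); last exact: A_L_epsL.
  rewrite -counit_epsLE -[in RHS](mulr1 (epsL x)) -lamh mulr_tliftr.
  rewrite lin_tlift; last exact: linearP.
  apply: eq_tlift => a b; rewrite -scalerAr (linZ (f := eps)) //.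
    exact: mulrC.
  exact: linearP.
by lin.
Qed.

Lemma antipode_haarE y : S y = \sw_(a, b <- Delta h) lam (y * b) *: a.
Proof.
rewrite (@sw_haarl _ _ H _ hh _ (fun a b => lam b *: a)); last by lin.
rewrite -[LHS]mulr1 -lamh mulr_tliftr.
by apply: eq_tlift => a b; rewrite -scalerAr.
Qed.

(** With a = phi(1_(1)) 1_(2) and S(y) = h_(1) lam(y h_(2)), [sw_counit_unit] at x = h contracts the
    coproduct of h. What remains is lam(y 1_(2) h), which is eps(y 1_(2)). *)
Lemma counit_antipode a y : A_L H a -> eps (a * S y) = eps (y * a).
Proof.
move=> [phi ->]; rewrite mulr_tliftl mulr_tliftr.
rewrite !lin_tlift; try exact: linearP.
transitivity (\sw_(u, v <- Delta 1) \sw_(a, b <- Delta h)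
    eps (v * a) *: (phi u *: lam (y * b))).
  apply: eq_tlift => u v; rewrite antipode_haarE mulr_tliftr.
  rewrite lin_tlift; last exact: linearP.
  apply: eq_tlift => c d; rewrite -scalerAr -scalerAl.
  rewrite !(linZ (f := eps)); try exact: linearP.
  by rewrite /GRing.scale /= mulrCA [RHS]mulrCA; congr (_ * _); exact: mulrC.
rewrite (@sw_counit_unit _ _ H _ (fun u b => phi u *: lam (y * b))); last by lin.
apply: eq_tlift => u v; rewrite mulrA lam_mul_haar -scalerAr.
by rewrite (linZ (f := eps)) //; exact: linearP.
Qed.

(** By [counit_antipode] at y = S^-1(q), the second dual factor evaluates at q to eps(a q). The
    counit then collapses Delta(a x), in which a stays in the first leg. *)
Lemma h_L_mul phi a : A_L H a ->
  h_L H h (dual_mul H phi (dual_antipode_inv H (lact_dual a (dual_one H))))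
  = a * h_L H h phi.
Proof.
move=> aL; transitivity (\sw_(x, y <- Delta h) \sw_(p, q <- Delta x)
    (phi p * eps (a * q)) *: y).
  apply: eq_tlift => x y; rewrite dual_mulE.
  rewrite (lin_tlift (g := fun c : R[i]^o => (c : R[i]) *: y)); last by lin.
  apply: eq_tlift => p q; congr ((_ * _) *: _).
  rewrite dual_antipode_invE lact_dualE -counit_antipode //.
  by rewrite (antipodeVK hh).
rewrite (@sw_coassoc _ _ H _ (fun p q y => (phi p * eps (a * q)) *: y)); last by lin.
rewrite /h_L /dual_ract mulr_tliftr; apply: eq_tlift => p x.
rewrite -scalerAr -[a * x](@sw_counitl _ _ H _ idfun) //.
rewrite (@sw_mulA_Ll _ _ H _ (fun u v => eps u *: v)) //; last by lin.
rewrite (lin_tlift (g := fun z => phi p *: z)); last by lin.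
by apply: eq_tlift => q y; rewrite scalerA.
Qed.

(** Evaluation at b gives phi(h_(1)) lam(S^-1(b) h_(2)); [sw_haarl] moves b to the first leg and
    lam(h_(2)) h_(1) = 1 finishes. *)
Lemma h_LK : cancel (h_L H h) (dual_antipode_inv H \o lambda_R lam).
Proof.
move=> phi; apply/lfunP => b /=; rewrite dual_antipode_invE lact_dualE.
rewrite /h_L /dual_ract mulr_tliftr lin_tlift; last exact: linearP.
transitivity (\sw_(p, q <- Delta h) phi p *: lam (S^-1%VF b * q)).
  apply: eq_tlift => p q; rewrite -scalerAr.
  by rewrite (linZ (f := lam)) //; exact: linearP.
rewrite (@sw_haarl _ _ H _ hh _ (fun p q => phi p *: lam q)); last by lin.
rewrite (antipodeVK hh) -[b in RHS]mulr1 -lamh mulr_tliftr.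
rewrite lin_tlift; last exact: linearP.
apply: eq_tlift => p q; rewrite -scalerAr (linZ (f := phi)).
  exact: mulrC.
exact: linearP.
Qed.

(** A left inverse makes [h_L] injective, and A and its dual have equal dimension, so [h_L] is also
    surjective. *)
Lemma inv_lambda_RK : cancel (dual_antipode_inv H \o lambda_R lam) (h_L H h).
Proof.
have [f fE] := lin_pack (linear_h_L h).
have kf : lker (linfun f) == 0%VS.
  by apply/lker0P; apply: (can_inj (g := dual_antipode_inv H \o lambda_R lam)) => x;
    rewrite lfunE fE h_LK.
have imf : limg (linfun f) = fullv.
  apply/eqP; rewrite eqEdim subvf /= limg_dim_eq; last by rewrite (eqP kf) capv0.
  by rewrite !dimvf /dim /= muln1.
move=> a; have /memv_imgP[phi _ ->] : a \in limg (linfun f) by rewrite imf memvf.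
by rewrite lfunE fE h_LK.
Qed.

End HaarIntegral.

End DualIntegral.

(** * Module algebras and crossed products *)

Section ModuleAlgebras.
Variables (R : realType) (A : falgType R[i]) (H : weakCstarHopf A).
Local Notation Delta := (Delta H).
Local Notation eps := (counit H).
Local Notation epsL := (epsL H).

Lemma sw_epsL_mul x : \sw_(a, b <- Delta x) epsL a * b = x.
Proof.
rewrite -[RHS](counitl H x) -[in RHS](mul1r x) sw_mul; last by lin.
rewrite exchange_tlift; apply: eq_tlift => a b.
rewrite epsLE mulr_tliftl; apply: eq_tlift => u v.
by rewrite -scalerAl.
Qed.

Lemma linear_epsL : linear epsL.
Proof. by rewrite /epsL; lin. Qed.

Section ModuleAlgebra.
Variables (M : algType R[i]) (starM : M -> M) (rho : {linear M -> tensor M (dual A)}).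
Hypothesis hrho : coaction H starM rho.
Local Notation act := (coact_act rho).

(** Delta l is 1_(1) l ⊗ 1_(2), so l acts on the factor 1 alone; the remaining Delta 1 recombines
    into the action of 1 on the product. *)
Lemma act_A_L l m : A_L H l -> act l m = act l 1 * m.
Proof.
move=> lL; rewrite -[m in LHS]mul1r (act_mul hrho).
rewrite (@sw_A_Lr _ _ H _ (fun a b => act a 1 * act b m)) //; last by lin.
rewrite -[RHS](act1 hrho) (act_mul hrho).
by apply: eq_tlift => u v; rewrite (actM hrho).
Qed.

Lemma act_A_R r m : A_R H r -> act r m = m * act r 1.
Proof.
move=> rR; rewrite -[m in LHS]mulr1 (act_mul hrho).
rewrite (@sw_A_R _ _ H _ (fun a b => act a m * act b 1)) //; last by lin.
rewrite -[RHS](act1 hrho) (act_mul hrho).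
by apply: eq_tlift => u v; rewrite (actM hrho).
Qed.

(* The element r = 1_(1) eps(1_(2) a) of A_R satisfies epsL r = epsL a, so  *)
(* that a and r act in the same way on the unit and on the fixed points.    *)
Lemma act_fixed n a : fixed_points H rho n -> act a n = n * act a 1.
Proof.
move=> nN; pose r := \sw_(u, v <- Delta 1) eps (v * a) *: u.
have rR : A_R H r.
  by exists (lact_dual a eps); apply: eq_tlift => u v; rewrite lact_dualE.
have era : epsL r = epsL a.
  rewrite !epsLE [RHS](_ : _ = \sw_(u, v <- Delta 1)
      (\sw_(u', v' <- Delta 1) (eps (u * u') * eps (v' * a))) *: v).
    apply: eq_tlift => u v; congr (_ *: _).
    rewrite /r mulr_tliftr lin_tlift; last exact: linearP.
    apply: eq_tlift => u' v'; rewrite -scalerAr (linZ (f := eps)).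
      exact: mulrC.
    exact: linearP.
  apply: eq_tlift => u v; congr (_ *: _).
  by rewrite -counit_weak mulr1.
by rewrite nN (act_unit hrho) -era -nN -(act_unit hrho) act_A_R.
Qed.

Lemma act_fixed_mul n a m : fixed_points H rho n -> act a (n * m) = n * act a m.
Proof.
move=> nN; rewrite -[m in RHS]mul1r !(act_mul hrho) mulr_tliftr.
by apply: eq_tlift => a1 a2; rewrite act_fixed // mulrA.
Qed.

End ModuleAlgebra.

End ModuleAlgebras.

(* The part of the proof that only uses Sweedler calculus.  In the          *)
(* application AL, eL and N are A_L, epsL and M^A, W is the dual of A with  *)
(* evaluation pairing ev, rmul phi a = phi S_hat^-1(a ⇀ 1_hat), hL = h_L   *)
(* and gL = S_hat^-1 \o lambda_R; crel, drel and nrel are the relations     *)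
(* defining the tensor products M ⊗_{A_L} A, M ⊗_{A_L} A_hat and M ⊗_N M.   *)
Section CrossedProduct.
Variables (K : fieldType) (A : falgType K) (M : algType K).
Variable D : {linear A -> tensor A A}.
Variables (act : A -> M -> M) (AL : set A) (eL : A -> A).
Hypothesis D_coassoc : forall (U : lmodType K) (F : A -> A -> A -> U) x,
  trilin F -> \sw_(p, c <- D x) \sw_(a, b <- D p) F a b c
              = \sw_(a, p <- D x) \sw_(b, c <- D p) F a b c.
Hypothesis D_ALl : forall (U : lmodType K) (F : A -> A -> U) l x,
  bilin F -> AL l ->
  \sw_(a, b <- D (l * x)) F a b = \sw_(a, b <- D x) F (l * a) b.
Hypothesis D_ALr : forall (U : lmodType K) (F : A -> A -> U) l x,
  bilin F -> AL l ->
  \sw_(a, b <- D (x * l)) F a b = \sw_(a, b <- D x) F (a * l) b.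
Hypotheses (eL_lin : linear eL) (eL_AL : forall x, AL (eL x)).
Hypothesis eL_mul : forall x, \sw_(a, b <- D x) eL a * b = x.
Hypothesis act_bilin : bilin act.
Hypothesis act1 : forall m, act 1 m = m.
Hypothesis actM : forall a b m, act (a * b) m = act a (act b m).
Hypothesis act_mul : forall a m n,
  act a (m * n) = \sw_(a1, a2 <- D a) act a1 m * act a2 n.
Hypothesis act_AL : forall l m, AL l -> act l m = act l 1 * m.
Hypothesis act_eL : forall a, act a 1 = act (eL a) 1.

Definition crel : set (tensor M A) :=
  [set z | exists m b a, AL b /\ z = m ⊗ (b * a) - (m * act b 1) ⊗ a].

Definition xtmul (t u : tensor M A) : tensor M A :=
  \sw_(m, a <- t) \sw_(m', a' <- u)
    \sw_(a1, a2 <- D a) (m * act a1 m') ⊗ (a2 * a').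

Definition xmul (p q : lquot crel) : lquot crel :=
  lpi crel (xtmul (lrepr p) (lrepr q)).

Definition xMhM (h : A) (m m' : M) : lquot crel :=
  xmul (xmul (lpi crel (m ⊗ 1)) (lpi crel (1 ⊗ h))) (lpi crel (m' ⊗ 1)).

Lemma bilin_xtmul : bilin xtmul.
Proof.
rewrite /xtmul; split=> u; last by lin.
by apply: lin_tlift_tensor; [exact: lin_id | split=> w; lin].
Qed.

Lemma xtmul_tens m a m' a' :
  xtmul (m ⊗ a) (m' ⊗ a')
  = \sw_(a1, a2 <- D a) (m * act a1 m') ⊗ (a2 * a').
Proof.
rewrite /xtmul tlift_tens; last by apply: bilin_balanced; lin.
by rewrite tlift_tens //; apply: bilin_balanced; lin.
Qed.

Lemma lpi_crel m b a : AL b ->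
  lpi crel (m ⊗ (b * a)) = lpi crel ((m * act b 1) ⊗ a).
Proof. by move=> bL; apply/lpi_eq/sub_lspan; exists m, b, a. Qed.

(** * Compatibility of the crossed product multiplication with the relations *)

Section AbstractQuotient.
Variables (Q : lmodType K) (pi : tensor M A -> Q).
Hypothesis piL : linear pi.
Hypothesis pi_rel : forall m b a, AL b ->
  pi (m ⊗ (b * a)) = pi ((m * act b 1) ⊗ a).

(** The two products already agree before projection: b stays in the first leg of Delta(b c) and
    acts as left multiplication by [act b 1]. *)
Lemma xtmul_crell z u : crel z -> pi (xtmul z u) = 0.
Proof.
move=> [n [b [c [bL ->]]]].
rewrite (linB (proj1 bilin_xtmul u)) (linB piL).
apply/eqP; rewrite subr_eq0; apply/eqP.
rewrite [u]tseqP !(lin_sum _ _ (proj2 bilin_xtmul _)).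
congr pi; apply: eq_bigr => -[m' a'] _ /=; rewrite !xtmul_tens.
rewrite (@D_ALl _ (fun a1 a2 => (n * act a1 m') ⊗ (a2 * a'))) //; last by lin.
by apply: eq_tlift => a1 a2; rewrite actM act_AL // !mulrA.
Qed.

(** Here the relation itself is needed. In a ▷ (n (b ▷ 1)) = (a_(1) ▷ n)(a_(2) b ▷ 1) the last
    factor depends only on eL(a_(2) b), which crosses the tensor sign, and eL(a_(2) b) a_(3) = a_(2)
    b. *)
Lemma xtmul_crelr t z : crel z -> pi (xtmul t z) = 0.
Proof.
move=> [n [b [c [bL ->]]]].
rewrite (linB (proj2 bilin_xtmul t)) (linB piL).
apply/eqP; rewrite subr_eq0; apply/eqP.
rewrite [t]tseqP !(lin_sum _ _ (proj1 bilin_xtmul _)) !(lin_sum _ _ piL).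
apply: eq_bigr => -[m0 a0] _ /=; rewrite !xtmul_tens !(lin_tlift _ _ piL).
transitivity (\sw_(x, y <- D a0) \sw_(p, q <- D x)
    pi ((m0 * (act p n * act (q * b) 1)) ⊗ (y * c))); last first.
  apply: eq_tlift => x y; rewrite act_mul mulr_tliftr.
  rewrite (lin_tlift (g := fun z => pi (z ⊗ (y * c)))); last by lin.
  by apply: eq_tlift => p q; rewrite actM.
rewrite (@D_coassoc _ (fun p q y =>
    pi ((m0 * (act p n * act (q * b) 1)) ⊗ (y * c)))); last by lin.
apply: eq_tlift => p x.
transitivity (\sw_(q, y <- D x)
    pi ((m0 * act p n) ⊗ (eL (q * b) * (y * c)))); last first.
  apply: eq_tlift => q y; rewrite pi_rel; last exact: eL_AL.
  by rewrite -act_eL mulrA.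
rewrite -(lin_tlift (g := fun z => pi ((m0 * act p n) ⊗ z))); last by lin.
congr (pi (_ ⊗ _)); rewrite mulrA -[x * b in LHS]eL_mul.
rewrite (@D_ALr _ (fun u v => eL u * v)) //; last by lin.
by rewrite mulr_tliftl; apply: eq_tlift => q y; rewrite mulrA.
Qed.

(** The product is m (1_(1) ▷ 1) ⊗ 1_(2) h; the first leg crosses as eL(1_(1)), and eL(1_(1)) 1_(2)
    = 1. *)
Lemma xtmul_unit h m :
  pi (xtmul (m ⊗ 1) (1 ⊗ h)) = pi (m ⊗ h).
Proof.
rewrite xtmul_tens (lin_tlift _ _ piL).
rewrite -[h in RHS]mul1r -[1 in RHS]eL_mul mulr_tliftl.
rewrite (lin_tlift (g := fun z => pi (m ⊗ z))); last by lin.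
by apply: eq_tlift => u v; rewrite -mulrA (pi_rel m (v * h) (eL_AL u)) -act_eL.
Qed.

Lemma xtmul_MhM h m m' :
  pi (xtmul (m ⊗ h) (m' ⊗ 1)) = \sw_(a, b <- D h) pi ((m * act a m') ⊗ b).
Proof.
rewrite xtmul_tens (lin_tlift _ _ piL).
by apply: eq_tlift => a b; rewrite mulr1.
Qed.
End AbstractQuotient.

Lemma xmulE t u : xmul (lpi crel t) (lpi crel u) = lpi crel (xtmul t u).
Proof.
apply: bilin_lrepr; first exact: bilin_xtmul.
- move=> z w zP; apply/lpi0P; apply: (xtmul_crell (pi := lpi crel)) => //.
  exact: linearP.
- move=> z w zP; apply/lpi0P; apply: (xtmul_crelr (pi := lpi crel)) => //.
    exact: linearP.
  exact: lpi_crel.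
Qed.

Lemma xMhME h m m' :
  xMhM h m m' = \sw_(a, b <- D h) lpi crel ((m * act a m') ⊗ b).
Proof.
rewrite /xMhM xmulE (xtmul_unit (pi := lpi crel)).
- by rewrite xmulE (xtmul_MhM (pi := lpi crel)) //; exact: linearP.
- exact: linearP.
- exact: lpi_crel.
Qed.

(** * The isomorphism F, the Galois map and the span of the elements m h m' *)

Section GaloisMap.
Variables (W : lmodType K) (rho : {linear M -> tensor M W}) (ev : W -> A -> K).
Variables (one : W) (wmul : W -> W -> W) (rmul : W -> A -> W).
Variables (h : A) (hL : W -> A) (gL : A -> W) (N : set M).
Hypotheses (wmul_bilin : bilin wmul) (wmul1 : forall phi, wmul one phi = phi).
Hypothesis rhoE : forall a m, act a m = \sw_(m0, phi <- rho m) ev phi a *: m0.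
Hypothesis hLE : forall phi, hL phi = \sw_(a, b <- D h) ev phi a *: b.
Hypotheses (hL_lin : linear hL) (gL_lin : linear gL).
Hypotheses (hLK : cancel hL gL) (gLK : cancel gL hL).
Hypothesis hL_rmul : forall phi a, AL a -> hL (rmul phi a) = a * hL phi.
Hypothesis act_N : forall n a m, N n -> act a (n * m) = n * act a m.
Hypothesis N_act : forall m, N (act h m).

Definition drel : set (tensor M W) :=
  [set z | exists m a phi, AL a /\
     z = (m * act a 1) ⊗ phi - m ⊗ rmul phi a].
Definition nrel : set (tensor M M) :=
  [set z | exists m n m', N n /\ z = (m * n) ⊗ m' - m ⊗ (n * m')].

Definition idhL : tensor M W -> tensor M A := tmap idfun hL.
Definition idgL : tensor M A -> tensor M W := tmap idfun gL.

Let id_lin : linear (@idfun M). Proof. by []. Qed.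

Lemma linear_idhL : linear idhL. Proof. exact: linear_tmap. Qed.
Lemma linear_idgL : linear idgL. Proof. exact: linear_tmap. Qed.
Lemma idhLK : cancel idhL idgL. Proof. exact: tmapK. Qed.
Lemma idgLK : cancel idgL idhL. Proof. exact: tmapK. Qed.

Definition Fmap (q : lquot drel) : lquot crel := lpi crel (idhL (lrepr q)).
Definition Finv (q : lquot crel) : lquot drel := lpi drel (idgL (lrepr q)).

Let lin_lpi_idhL : linear (fun t => lpi crel (idhL t)).
Proof. by have L := linear_idhL; lin. Qed.
Let lin_lpi_idgL : linear (fun t => lpi drel (idgL t)).
Proof. by have L := linear_idgL; lin. Qed.

Lemma lpi_drel m a phi : AL a ->
  lpi drel (m ⊗ rmul phi a) = lpi drel ((m * act a 1) ⊗ phi).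
Proof.
move=> aL; apply/esym/lpi_eq/sub_lspan; by exists m, a, phi.
Qed.

Lemma idhL_drel z : drel z -> lpi crel (idhL z) = 0.
Proof.
move=> [m [a [phi [aL ->]]]]; rewrite (linB lin_lpi_idhL).
apply/eqP; rewrite subr_eq0; apply/eqP.
by rewrite /idhL !tmap_tens // hL_rmul // lpi_crel.
Qed.

Lemma idgL_crel z : crel z -> lpi drel (idgL z) = 0.
Proof.
move=> [m [b [a [bL ->]]]]; rewrite (linB lin_lpi_idgL).
apply/eqP; rewrite subr_eq0; apply/eqP.
(* Writing a = hL(gL a) gives b a = hL(rmul (gL a) b), so [gL] carries left multiplication by b to
   [rmul]. *)
by rewrite /idgL !tmap_tens // -{1}[a]gLK -hL_rmul // hLK lpi_drel.
Qed.

Lemma FmapE t : Fmap (lpi drel t) = lpi crel (idhL t).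
Proof. exact: (lin_lrepr lin_lpi_idhL idhL_drel). Qed.
Lemma FinvE t : Finv (lpi crel t) = lpi drel (idgL t).
Proof. exact: (lin_lrepr lin_lpi_idgL idgL_crel). Qed.

Lemma linear_Fmap : linear Fmap.
Proof. exact: (linear_lquot lin_lpi_idhL idhL_drel). Qed.
Lemma linear_Finv : linear Finv.
Proof. exact: (linear_lquot lin_lpi_idgL idgL_crel). Qed.

Lemma FmapK : cancel Fmap Finv.
Proof. by move=> q; rewrite -[q]lreprK FmapE FinvE idhLK. Qed.
Lemma FinvK : cancel Finv Fmap.
Proof. by move=> q; rewrite -[q]lreprK FinvE FmapE idgLK. Qed.

Definition dlmul (m : M) (q : lquot drel) : lquot drel :=
  lpi drel (tmap ( *%R m) idfun (lrepr q)).
Definition xlmul (m : M) (q : lquot crel) : lquot crel :=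
  lpi crel (tmap ( *%R m) idfun (lrepr q)).

Lemma xlmulE m t : xlmul m (lpi crel t) = lpi crel (tmap ( *%R m) idfun t).
Proof.
have mL : linear ( *%R m : M -> M) by move=> c x y; rewrite mulrDr -scalerAr.
have L : linear (tmap ( *%R m) (@idfun A)) by exact: linear_tmap.
rewrite /xlmul (lin_lrepr (f := fun t => lpi crel (tmap ( *%R m) idfun t))) //.
  by lin.
move=> _ [m0 [b [a [bL ->]]]]; rewrite (linB L) raddfB /=.
apply/eqP; rewrite subr_eq0; apply/eqP.
by rewrite !tmap_tens //= lpi_crel // mulrA.
Qed.

(** By definition [dlmul m q] is a projected tensor, so well-definedness is needed only for [xlmul];
    the statement for [Finv] then follows by inversion. *)
Lemma Fmap_lmul m q : Fmap (dlmul m q) = xlmul m (Fmap q).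
Proof.
have mL : linear ( *%R m : M -> M) by move=> c x y; rewrite mulrDr -scalerAr.
rewrite FmapE xlmulE; congr lpi.
rewrite [lrepr q]tseqP /idhL !tmap_sum //; apply: eq_bigr => p _.
by rewrite !tmap_tens.
Qed.

Lemma Finv_lmul m q : Finv (xlmul m q) = dlmul m (Finv q).
Proof. by apply: (can_inj FmapK); rewrite FinvK Fmap_lmul FinvK. Qed.

Definition gam (t : lquot nrel) : lquot drel :=
  \sw_(m, m' <- lrepr t) lpi drel (tmul *%R wmul (m ⊗ one) (rho m')).

Let gam0 (m m' : M) : lquot drel :=
  lpi drel (tmul *%R wmul (m ⊗ one) (rho m')).

(** Pairing the dual leg of rho(m') with h_(1) is the action of h_(1) on m', which leaves m (h_(1) ▷
    m') ⊗ h_(2). *)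
Lemma Fmap_gam0 m m' : Fmap (gam0 m m') = xMhM h m m'.
Proof.
have iL := linear_idhL; have lL : linear (lpi crel) by exact: linearP.
rewrite FmapE xMhME /tmul tlift_tens; last by apply: bilin_balanced; lin.
rewrite (lin_tlift _ _ lin_lpi_idhL).
transitivity (\sw_(m0, phi <- rho m') \sw_(a, b <- D h)
   ev phi a *: lpi crel ((m * m0) ⊗ b)).
  apply: eq_tlift => m0 phi; rewrite wmul1 /idhL tmap_tens // hLE.
  rewrite (lin_tlift (g := fun z => lpi crel ((m * m0) ⊗ z))); last by lin.
  by apply: eq_tlift => a b; rewrite tensZr linearZ.
rewrite exchange_tlift; apply: eq_tlift => a b; rewrite rhoE mulr_tliftr.
rewrite (lin_tlift (g := fun z => lpi crel (z ⊗ b))); last by lin.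
by apply: eq_tlift => m0 phi; rewrite -scalerAr tensZl linearZ.
Qed.

Lemma bilin_gam0 : bilin gam0.
Proof.
have lL : linear (lpi drel) by exact: linearP.
by rewrite /gam0 /tmul; split=> m; lin.
Qed.

Let gamT (t : tensor M M) := tlift t gam0.

Lemma linear_gamT : linear gamT.
Proof. by have gB := bilin_gam0; rewrite /gamT; lin. Qed.

(** The comparison is made after the injective [Fmap], where it reduces to h_(1) ▷ (n m') = n (h_(1)
    ▷ m'). *)
Lemma gamT_nrel z : nrel z -> gamT z = 0.
Proof.
move=> [m [n [m' [nN ->]]]]; rewrite (linB linear_gamT) /gamT.
rewrite !tlift_tens; try exact/bilin_balanced/bilin_gam0.
apply/eqP; rewrite subr_eq0; apply/eqP/(can_inj FmapK).
rewrite !Fmap_gam0 !xMhME; apply: eq_tlift => a b.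
by rewrite act_N // mulrA.
Qed.

Lemma gamE t : gam (lpi nrel t) = gamT t.
Proof. exact: (lin_lrepr linear_gamT gamT_nrel). Qed.

Lemma linear_gam : linear gam.
Proof. exact: (linear_lquot linear_gamT gamT_nrel). Qed.

Lemma gam_tens m m' : Fmap (gam (lpi nrel (m ⊗ m'))) = xMhM h m m'.
Proof.
by rewrite gamE /gamT tlift_tens ?Fmap_gam0 //; exact/bilin_balanced/bilin_gam0.
Qed.

Let xact (x : M) (q : lquot crel) : M := \sw_(m, a <- lrepr q) (m * act a x).

Lemma xactE x t : xact x (lpi crel t) = \sw_(m, a <- t) (m * act a x).
Proof.
rewrite /xact (lin_lrepr (f := fun t : tensor M A => \sw_(m, a <- t) (m * act a x))) //.
  by lin.
move=> _ [m [b [a [bL ->]]]].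
have B : bilin (fun m a => m * act a x) by lin.
rewrite (linB (f := fun t : tensor M A => \sw_(m, a <- t) (m * act a x))); last by lin.
rewrite !tlift_tens; try exact: bilin_balanced.
by rewrite actM act_AL // mulrA subrr.
Qed.

Lemma linear_xact x : linear (xact x).
Proof.
move=> c p q; rewrite -[p]lreprK -[q]lreprK -linearP !xactE.
have L : linear (fun t : tensor M A => \sw_(m, a <- t) (m * act a x)) by lin.
exact: L.
Qed.

Lemma xact_MhM x m m' : xact x (xMhM h m m') = m * act h (m' * x).
Proof.
rewrite xMhME (lin_tlift _ _ (linear_xact x)) act_mul mulr_tliftr.
apply: eq_tlift => a b; rewrite xactE tlift_tens ?mulrA //.
by apply: bilin_balanced; lin.
Qed.

Lemma gam_inj (s : seq (M * M)) :
  (forall m, \sum_(p <- s) act h (m * p.1) * p.2 = m) -> injective gam.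
Proof.
move=> sE q q' /eqP; rewrite -subr_eq0 -(linB linear_gam) => /eqP q0.
apply/eqP; rewrite -subr_eq0; apply/eqP; move: (q - q') q0 => {q q'} q.
rewrite -[q]lreprK; move: (lrepr q) => {q} t gt0.
have t0 x : \sw_(m, m' <- t) (m * act h (m' * x)) = 0.
  rewrite -(lin0 (linear_xact x)) -(lin0 linear_Fmap) -gt0 gamE /gamT.
  rewrite (lin_tlift _ _ linear_Fmap) (lin_tlift _ _ (linear_xact x)).
  by apply: eq_tlift => m m'; rewrite Fmap_gam0 xact_MhM.
have lL : linear (lpi nrel) by exact: linearP.
rewrite [t]tseqP raddf_sum /=.
transitivity (\sum_(p <- s) lpi nrel ((\sw_(m, m' <- t) (m * act h (m' * p.1))) ⊗ p.2)).
  under [RHS]eq_bigr => p _.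
    rewrite (lin_tlift (g := fun z => lpi nrel (z ⊗ p.2))); last by lin.
    over.
  rewrite exchange_big; apply: eq_bigr => -[m m'] _ /=.
  rewrite -[m' in LHS]sE (lin_sum _ _ (f := fun z => lpi nrel (m ⊗ z))); last by lin.
  apply: eq_bigr => p _; apply/esym/lpi_eq/sub_lspan.
  (* The value of E_h lies in N and may therefore cross the tensor sign. *)
  by exists m, (act h (m' * p.1)), p.2.
rewrite big1 // => p _; rewrite t0.
by rewrite (lin0 (f := fun z => lpi nrel (z ⊗ p.2))) //; lin.
Qed.

Definition xMhMspan : set (lquot crel) :=
  lspan [set x | exists m m', x = xMhM h m m'].

Lemma gam_surj : xMhMspan = setT -> forall q, exists t, gam t = q.
Proof.
move=> full q; suff [t tE] : exists t, Fmap (gam t) = Fmap q.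
  by exists t; exact: (can_inj FmapK).
have : xMhMspan (Fmap q) by rewrite full.
move=> [s sP ->]; elim: s sP => [|p s IHs] sP.
  exists 0; rewrite big_nil.
  by rewrite (lin0 linear_gam) (lin0 linear_Fmap).
have [|t tE] := IHs; first by move=> r rs; apply: sP; rewrite inE rs orbT.
have [m [m' pE]] := sP p (mem_head _ _).
exists (p.1 *: lpi nrel (m ⊗ m') + t).
by rewrite linear_gam linear_Fmap gam_tens tE big_cons pE.
Qed.

Lemma gam_span : (forall q, exists t, gam t = q) -> xMhMspan = setT.
Proof.
move=> gsurj; apply/seteqP; split=> // q _.
have [t tE] := gsurj (Finv q).
exists [seq (1, xMhM h p.1 p.2) | p <- tseq (lrepr t)].
  by move=> p /mapP[r _ ->]; exists r.1, r.2.
rewrite -[q]FinvK -tE -[t in LHS]lreprK gamE /gamT (lin_tlift _ _ linear_Fmap).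
rewrite big_map; apply: eq_bigr => p _.
by rewrite scale1r Fmap_gam0.
Qed.

Lemma span_quasi_basis : xMhMspan = setT ->
  exists s : seq (M * M), forall m, \sum_(p <- s) p.1 * act h (p.2 * m) = m.
Proof.
move=> full; have : xMhMspan (lpi crel (1 ⊗ 1)) by rewrite full.
move=> [s sP sE].
(* The scalars of the linear combination are absorbed into the left factors. *)
have {sP} [r rE] : exists r : seq (M * M),
    \sum_(p <- s) p.1 *: p.2 = \sum_(p <- r) xMhM h p.1 p.2.
  elim: s sP {sE} => [|p s IHs] sP; first by exists [::]; rewrite !big_nil.
  have [|r rE] := IHs; first by move=> t ts; apply: sP; rewrite inE ts orbT.
  have [m [m' pE]] := sP p (mem_head _ _).
  exists ((p.1 *: m, m') :: r); rewrite !big_cons rE pE /=; congr (_ + _).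
  rewrite !xMhME (lin_tlift (g := fun z => p.1 *: z)); last by lin.
  by apply: eq_tlift => a b; rewrite -scalerAl tensZl linearZ.
exists r => m; rewrite rE in sE.
transitivity (xact m (lpi crel (1 ⊗ 1))); last first.
  rewrite xactE tlift_tens ?act1 ?mul1r //.
  by apply: bilin_balanced; lin.
rewrite sE (lin_sum _ _ (linear_xact m)).
by apply: eq_bigr => p _; rewrite xact_MhM.
Qed.

(** The exchange of left and right quasi-bases relies on the involution of M, which is absent from
    this abstract setting. *)
Hypothesis quasi_basis_star : forall s : seq (M * M),
  (forall m, \sum_(p <- s) p.1 * act h (p.2 * m) = m) ->
  exists s' : seq (M * M), forall m, \sum_(p <- s') act h (m * p.1) * p.2 = m.

Lemma gam_bij : bijective gam <-> xMhMspan = setT.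
Proof.
split=> [[g gK Kg]|full]; first by apply: gam_span => q; exists (g q).
have [s /quasi_basis_star[s' s'E]] := span_quasi_basis full.
have [g Kg] := choice (gam_surj full).
by exists g => // t; apply: (gam_inj s'E).
Qed.

Theorem galois_map :
  [/\ [/\ cancel idhL idgL, cancel idgL idhL
        & exists (F : {linear lquot drel -> lquot crel})
                 (F' : {linear lquot crel -> lquot drel}),
          [/\ [/\ forall t, F (lpi drel t) = lpi crel (idhL t)
                & forall t, F' (lpi crel t) = lpi drel (idgL t)],
              cancel F F' /\ cancel F' F,
              (forall m q, F (dlmul m q) = xlmul m (F q)) /\
              (forall m q, F' (xlmul m q) = dlmul m (F' q))
            & forall m m', F (gam (lpi nrel (m ⊗ m'))) = xMhM h m m'] ],
      (exists s : seq (M * M), forall m,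
         \sum_(p <- s) p.1 * act h (p.2 * m) = m
         /\ \sum_(p <- s) act h (m * p.1) * p.2 = m) -> injective gam
    & bijective gam <-> xMhMspan = setT ].
Proof.
split; last exact: gam_bij.
  split; [exact: idhLK|exact: idgLK|].
  have [F FE] := lin_pack linear_Fmap; have [F' FE'] := lin_pack linear_Finv.
  exists F, F'; rewrite FE FE'; split.
  - by split; [exact: FmapE|exact: FinvE].
  - by split; [exact: FmapK|exact: FinvK].
  - by split; [exact: Fmap_lmul|exact: Finv_lmul].
  - exact: gam_tens.
by move=> [s sE]; apply: (@gam_inj s) => m; case: (sE m).
Qed.

End GaloisMap.
End CrossedProduct.

(** * Specialization to the weak Hopf algebra and its coaction *)

Lemma quasi_basis_star (R : realType) (A : falgType R[i]) (H : weakCstarHopf A)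
    (M : algType R[i]) (starM : M -> M) (rho : {linear M -> tensor M (dual A)})
    (h : A) (s : seq (M * M)) :
  coaction H starM rho -> haar_integral H h ->
  (forall m, \sum_(p <- s) p.1 * coact_act rho h (p.2 * m) = m) ->
  exists s' : seq (M * M), forall m,
    \sum_(p <- s') coact_act rho h (m * p.1) * p.2 = m.
Proof.
move=> hrho hh sE; have sM := modalg_star hrho.
have sK := star_invol sM; have sMul := star_antimul sM.
have sD x y : starM (x + y) = starM x + starM y.
  by have := star_antilinear sM 1 x y; rewrite rmorph1 !scale1r.
have s0 : starM 0 = 0 by apply: (addrI (starM 0)); rewrite -sD !addr0.
(* Applying the involution to the left identity at [starM m] reverses the products, and E_h commutes
   with it because h_* = h. *)
exists [seq (starM p.2, starM p.1) | p <- s] => m.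
rewrite big_map -[RHS]sK -[in RHS](sE (starM m)).
rewrite (big_morph starM sD s0); apply: eq_bigr => p _ /=.
by rewrite sMul (act_star hrho) (substar_haar hh) sMul sK.
Qed.

Theorem propositionA3 (R : realType) (A : falgType R[i]) (H : weakCstarHopf A)
    (M : algType R[i]) (starM : M -> M) (rho : {linear M -> tensor M (dual A)})
    (h : A) (lam : dual A)
    (hrho : coaction H starM rho)
    (hh : haar_integral H h)
    (hlam : dual_left_integral H h lam) :
  let id_hL : tensor M (dual A) -> tensor M A := tmap idfun (h_L H h) in
  let id_SlamR : tensor M A -> tensor M (dual A) :=
    tmap idfun (dual_antipode_inv H \o lambda_R lam) in
  [/\ [/\ cancel id_hL id_SlamR,
          cancel id_SlamR id_hL
        & exists (F : {linear tensDual H rho -> cross H rho})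
                 (Finv : {linear cross H rho -> tensDual H rho}),
          [/\ [/\ forall t, F (tensDual_pi H rho t) = cross_pi H rho (id_hL t)
                & forall t, Finv (cross_pi H rho t)
                            = tensDual_pi H rho (id_SlamR t)],
              cancel F Finv /\ cancel Finv F,
              (forall m q, F (tensDual_lmul m q) = cross_lmul m (F q)) /\
              (forall m q, Finv (cross_lmul m q) = tensDual_lmul m (Finv q))
            & forall m m', F (gamma H rho (tensN_pi H rho (m ⊗ m')))
                          = MhM_elt H rho h m m'] ],
      index_finite (cond_exp rho h) -> injective (gamma H rho)
    & bijective (gamma H rho) <-> MhM H rho h = [set: cross H rho] ].
Proof.
have lamh := proj2 hlam.
have wB : bilin (dual_mul H).
  split=> psi c x y; apply/lfunP => z.
    rewrite add_lfunE scale_lfunE !dual_mulE.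
    have L : linear (fun x : dual A => \sw_(a, b <- Delta H z) (x a * psi b : R[i]^o)).
      apply: lin_tlift_body => a b; apply: lin_mulr => d u v.
      by rewrite add_lfunE scale_lfunE.
    exact: L.
  rewrite add_lfunE scale_lfunE !dual_mulE.
  have L : linear (fun x : dual A => \sw_(a, b <- Delta H z) (psi a * x b : R[i]^o)).
    apply: lin_tlift_body => a b; apply: lin_mull => d u v.
    by rewrite add_lfunE scale_lfunE.
  exact: L.
pose rmul (phi : dual A) a :=
  dual_mul H phi (dual_antipode_inv H (lact_dual a (dual_one H))).
have G := @galois_map R[i] A M (Delta H) (coact_act rho) (A_L H) (epsL H)
  (fun U F x => @sw_coassoc _ _ H U F x) (fun U F l x FB => @sw_mulA_Ll _ _ H U F FB l x)
  (fun U F l x FB => @sw_mulA_Lr _ _ H U F FB l x) (linear_epsL H) (A_L_epsL H)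
  (sw_epsL_mul H) (coact_act_bilin rho) (act1 hrho) (actM hrho) (act_mul hrho)
  (act_A_L hrho) (act_unit hrho).
(* E_h takes values in the fixed points because a h = epsL(a) h. *)
have N_act m : fixed_points H rho (coact_act rho h m).
  by move=> a; rewrite -!(actM hrho) (haar_left hh).
(* With evaluation as the pairing, the formulas for [act] and [hL] are their definitions, whence the
   two [erefl]. *)
have {}G := G (dual A) rho (fun phi => phi) (dual_one H) (dual_mul H) rmul h (h_L H h)
  (dual_antipode_inv H \o lambda_R lam) (fixed_points H rho) wB (dual_one_mul H)
  (fun _ _ => erefl) (fun _ => erefl) (linear_h_L H h) (linear_inv_lambda_R H lam)
  (h_LK hh lamh) (inv_lambda_RK hh lamh)
  (fun phi a => h_L_mul hh lamh phi (a := a))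
  (fun n a m => act_fixed_mul hrho (n := n) a m) N_act
  (fun s => quasi_basis_star hrho hh).
(* The concrete relations, quotients and products unfold to the abstract ones, so the two statements
   are convertible. *)
exact: G.
Qed.
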